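(* Let $X$ be a compact length space with $\operatorname{diam}(X)>0$ which admits a universal cover $\rho:\widetilde X\to X$, and suppose $\pi_1(X)$ is finite of order $n$ (so $\rho$ is an $n$-fold covering). Equip $\widetilde X$ with the lifted length metric. Then $\operatorname{diam}(\widetilde X)<4\sqrt{n}\,\operatorname{diam}(X)$.
   Context: The lifted length metric on $\widetilde X$ is the unique length structure on $\widetilde X$ such that for every curve $\gamma:[0,1]\to\widetilde X$ one has $\ell(\gamma)=\ell(\rho\circ\gamma)$, where $\ell$ denotes length; distances in $\widetilde X$ are infima of lengths of curves joining the points. *)

(* Defs.v *)
From Stdlib Require Import Reals Lra List.
Open Scope R_scope.

Definition is_topology {T : Type} (op : (T -> Prop) -> Prop) : Prop :=
  op (fun _ => True) /\
  (forall U V, op U -> op V -> op (fun x => U x /\ V x)) /\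
  (forall (I : Type) (F : I -> T -> Prop),
      (forall i, op (F i)) -> op (fun x => exists i, F i x)).

Definition continuous {A B : Type} (opA : (A -> Prop) -> Prop)
  (opB : (B -> Prop) -> Prop) (f : A -> B) : Prop :=
  forall W, opB W -> opA (fun z => W (f z)).

Definition continuous_on {A B : Type} (opA : (A -> Prop) -> Prop)
  (opB : (B -> Prop) -> Prop) (S : A -> Prop) (f : A -> B) : Prop :=
  forall x, S x -> forall W, opB W -> W (f x) ->
    exists O, opA O /\ O x /\ forall y, S y -> O y -> W (f y).

Definition unitI (t : R) : Prop := 0 <= t <= 1.

Definition path_cont {T : Type} (op : (T -> Prop) -> Prop) (g : R -> T) : Prop :=
  forall t, unitI t -> forall W, op W -> W (g t) ->
    exists delta, delta > 0 /\
      forall s, unitI s -> Rabs (s - t) < delta -> W (g s).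

Definition is_path {T : Type} (op : (T -> Prop) -> Prop) (g : R -> T) (a b : T)
  : Prop := path_cont op g /\ g 0 = a /\ g 1 = b.

Definition cont2 {T : Type} (op : (T -> Prop) -> Prop) (H : R -> R -> T) : Prop :=
  forall s t, unitI s -> unitI t -> forall W, op W -> W (H s t) ->
    exists delta, delta > 0 /\
      forall s' t', unitI s' -> unitI t' -> Rabs (s' - s) < delta ->
        Rabs (t' - t) < delta -> W (H s' t').

Definition homotopic {T : Type} (op : (T -> Prop) -> Prop) (g1 g2 : R -> T)
  : Prop :=
  exists H : R -> R -> T, cont2 op H /\
    (forall t, unitI t -> H 0 t = g1 t /\ H 1 t = g2 t) /\
    (forall s, unitI s -> H s 0 = g1 0 /\ H s 1 = g1 1).

Definition simply_connected {T : Type} (op : (T -> Prop) -> Prop) : Prop :=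
  (forall a b : T, exists g, is_path op g a b) /\
  (forall (g : R -> T) (x : T), is_path op g x x -> homotopic op g (fun _ => x)).

Definition pi1_card {T : Type} (op : (T -> Prop) -> Prop) (x0 : T) (n : nat)
  : Prop :=
  exists L : nat -> R -> T,
    (forall i, (i < n)%nat -> is_path op (L i) x0 x0) /\
    (forall i j, (i < n)%nat -> (j < n)%nat -> homotopic op (L i) (L j) -> i = j) /\
    (forall g, is_path op g x0 x0 -> exists i, (i < n)%nat /\ homotopic op g (L i)).

Definition evenly_covered {E B : Type} (opE : (E -> Prop) -> Prop)
  (opB : (B -> Prop) -> Prop) (p : E -> B) (U : B -> Prop) : Prop :=
  exists (J : Type) (V : J -> E -> Prop),
    (forall j, opE (V j)) /\
    (forall z, U (p z) <-> exists j, V j z) /\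
    (forall j k z, V j z -> V k z -> j = k) /\
    (forall j, exists g : B -> E,
        (forall x, U x -> V j (g x) /\ p (g x) = x) /\
        (forall z, V j z -> g (p z) = z) /\
        continuous_on opB opE U g).

Definition covering_map {E B : Type} (opE : (E -> Prop) -> Prop)
  (opB : (B -> Prop) -> Prop) (p : E -> B) : Prop :=
  continuous opE opB p /\
  (forall x : B, exists z : E, p z = x) /\
  (forall x : B, exists U, opB U /\ U x /\ evenly_covered opE opB p U).

Definition universal_cover {E B : Type} (opE : (E -> Prop) -> Prop)
  (opB : (B -> Prop) -> Prop) (p : E -> B) : Prop :=
  is_topology opE /\ covering_map opE opB p /\ simply_connected opE.

Definition is_metric {X : Type} (d : X -> X -> R) : Prop :=
  (forall x y, 0 <= d x y) /\ (forall x y, d x y = 0 <-> x = y) /\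
  (forall x y, d x y = d y x) /\ (forall x y z, d x z <= d x y + d y z).

Definition mopen {X : Type} (d : X -> X -> R) (U : X -> Prop) : Prop :=
  forall x, U x -> exists e, e > 0 /\ forall y, d x y < e -> U y.

Definition compact_metric {X : Type} (d : X -> X -> R) : Prop :=
  forall (I : Type) (F : I -> X -> Prop),
    (forall i, mopen d (F i)) -> (forall x, exists i, F i x) ->
    exists l : list I, forall x, exists i, In i l /\ F i x.

Definition is_diam {X : Type} (d : X -> X -> R) (D : R) : Prop :=
  (forall x y, d x y <= D) /\
  (forall e, e > 0 -> exists x y, d x y > D - e).

Fixpoint psum {X : Type} (d : X -> X -> R) (g : R -> X) (t : nat -> R) (k : nat)
  : R :=
  match k with
  | O => 0
  | S k' => psum d g t k' + d (g (t k')) (g (t (S k')))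
  end.

Definition length_le {X : Type} (d : X -> X -> R) (g : R -> X) (L : R) : Prop :=
  forall (k : nat) (t : nat -> R), t O = 0 -> t k = 1 ->
    (forall i, (i < k)%nat -> t i <= t (S i)) -> psum d g t k <= L.

Definition length_space {X : Type} (d : X -> X -> R) : Prop :=
  is_metric d /\
  forall x y eps, eps > 0 ->
    exists g, is_path (mopen d) g x y /\ length_le d g (d x y + eps).

(* lifted length metric on the cover: dist(a,b) <= D, where
   dist(a,b) = inf { length(p o g) : g path in E from a to b } *)
Definition lifted_dist_le {E X : Type} (opE : (E -> Prop) -> Prop)
  (d : X -> X -> R) (p : E -> X) (a b : E) (D : R) : Prop :=
  forall eps, eps > 0 ->
    exists g, is_path opE g a b /\ length_le d (fun t => p (g t)) (D + eps).

(* Main.v *)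
Require Import Defs.
From Stdlib Require Import Reals Lra Lia List Classical ClassicalEpsilon ProofIrrelevance.
From Stdlib Require Bool FinFun.
From Coquelicot Require Import Compactness.
Open Scope R_scope.

(** Let e be the lifted metric, D = diam X, and let p, q satisfy e(p,q) > 2mD. For
    each j < m consider the set of points whose distance to p is about (2j+1)D. Since
    the cover is simply connected, a single component C of this set (for chains with
    steps smaller than eps) separates p from q. Put k = min(j, m-1-j), so that both p
    and q are at distance at least (2k+1)D from C. Then C has diameter at least 2kD:
    otherwise a deck transformation g carrying a point c0 of C to within D of p maps C
    into the component U of p in the complement of C, and then also maps U or the
    component V of q into U minus g c0. Counting points of the orbit of c0 gives
    #V < #U, and by symmetry #U < #V. Hence C passes within D of k+1 points of the fibre
    of p, and the points obtained for different j are distinct. Together with p this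
    gives n >= 1 + sum_j (1 + min(j, m-1-j)) = 1 + floor((m+1)^2/4). So e <= 2mD as soon
    as (m+1)^2 >= 4n; the least such m satisfies m^2 < 4n, i.e. 2mD < 4 sqrt(n) D. *)

(** * Chains and coverings at a given scale *)

(** Chains replace curves. The last index is the length, so that infima of lengths are approximated
    by finite data. *)
Inductive chain {Y : Type} (m : Y -> Y -> R) (eps : R) (a : Y) : Y -> R -> Prop :=
| chain_nil : chain m eps a a 0
| chain_snoc b c l : chain m eps a b l -> m b c < eps -> chain m eps a c (l + m b c).

(** Partially applied, [linked m eps S a] serves as the component of [a] in [S]. *)
Inductive linked {Y : Type} (m : Y -> Y -> R) (eps : R) (S : Y -> Prop) (a : Y)
  : Y -> Prop :=
| linked_refl : S a -> linked m eps S a a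
| linked_snoc b c : linked m eps S a b -> S c -> m b c < eps -> linked m eps S a c.

(* A covering "at scale eps" of Y, with total space S: [tr s y] is the point
   above y next to s, meaningful when y is eps-close to [pr s]. *)
Definition coherent {Y S : Type} (m : Y -> Y -> R) (pr : S -> Y)
  (tr : S -> Y -> S) (eps : R) : Prop :=
  (forall s y, pr (tr s y) = y) /\
  (forall s, tr s (pr s) = s) /\
  (forall s y y', m (pr s) y < eps -> m y y' < eps -> m (pr s) y' < eps ->
     tr (tr s y) y' = tr s y').

Inductive reach {Y S : Type} (m : Y -> Y -> R) (pr : S -> Y)
  (tr : S -> Y -> S) (eps : R) (s : S) : S -> Prop :=
| reach_refl : reach m pr tr eps s s
| reach_snoc s' y : reach m pr tr eps s s' -> m (pr s') y < eps ->
    reach m pr tr eps s (tr s' y).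

(** Simple connectivity in discrete form. Quantifying over all coverings lets it be applied both to
    pairs of points in a common fibre, which gives deck transformations, and to a double cover,
    which gives separation. *)
Definition trivial_monodromy {Y : Type} (m : Y -> Y -> R) : Prop :=
  forall (S : Type) (pr : S -> Y) (tr : S -> Y -> S) (eps : R), eps > 0 ->
    coherent m pr tr eps ->
    forall s s', reach m pr tr eps s s' -> pr s = pr s' -> s = s'.

Lemma linked_in {Y : Type} (m : Y -> Y -> R) eps S a b :
  linked m eps S a b -> S a /\ S b.
Proof. induction 1; tauto. Qed.

Lemma linked_trans {Y : Type} (m : Y -> Y -> R) eps S a b c :
  linked m eps S a b -> linked m eps S b c -> linked m eps S a c.
Proof. intros H H'; induction H'; eauto using @linked. Qed.

Lemma linked_sub {Y : Type} (m : Y -> Y -> R) eps (S S' : Y -> Prop) a b :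
  (forall x, S x -> S' x) -> linked m eps S a b -> linked m eps S' a b.
Proof. intros HS H; induction H; eauto using @linked. Qed.

Lemma linked_sym {Y : Type} (m : Y -> Y -> R) eps S a b :
  (forall x y, m x y = m y x) ->
  linked m eps S a b -> linked m eps S b a.
Proof.
  intros sym H; induction H as [Ha | b c Hab IH Hc Hbc].
  - now constructor.
  - apply linked_trans with b; [|exact IH].
    apply linked_snoc with c; [now constructor| |now rewrite sym].
    now apply linked_in in Hab.
Qed.

Lemma linked_map {Y Z : Type} (m : Y -> Y -> R) (m' : Z -> Z -> R) eps
  (S : Y -> Prop) (S' : Z -> Prop) (f : Y -> Z) a b :
  (forall x y, m' (f x) (f y) = m x y) -> (forall x, S x -> S' (f x)) ->
  linked m eps S a b -> linked m' eps S' (f a) (f b).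
Proof.
  intros Hf HS H; induction H.
  - constructor; auto.
  - apply linked_snoc with (f b); auto. now rewrite Hf.
Qed.

Lemma linked_first_hit {Y : Type} (m : Y -> Y -> R) eps (S T : Y -> Prop) a b :
  linked m eps S a b -> T b -> ~ T a ->
  exists x y, linked m eps (fun z => S z /\ ~ T z) a x /\ m x y < eps /\ S y /\ T y.
Proof.
  intros H Hb Ha.
  assert (Hx : linked m eps (fun z => S z /\ ~ T z) a b \/
    exists x y, linked m eps (fun z => S z /\ ~ T z) a x /\ m x y < eps /\ S y /\ T y).
  { clear Hb. induction H as [HS | b c Hab [IH|IH] Hc Hbc]; auto.
    - left. now constructor.
    - destruct (classic (T c)) as [Tc|Tc].
      + right. now exists b, c.
      + left. apply linked_snoc with b; auto. }
  destruct Hx as [Hx|Hx]; [|exact Hx].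
  apply linked_in in Hx. tauto.
Qed.

Section Reach.
Variables (Y S : Type) (m : Y -> Y -> R) (pr : S -> Y) (tr : S -> Y -> S) (eps : R).
Hypothesis m_sym : forall x y, m x y = m y x.
Hypothesis m_refl : forall x, m x x = 0.
Hypothesis eps_pos : eps > 0.
Hypothesis coh : coherent m pr tr eps.

Lemma reach_trans s1 s2 s3 :
  reach m pr tr eps s1 s2 -> reach m pr tr eps s2 s3 -> reach m pr tr eps s1 s3.
Proof. intros H H'; induction H'; eauto using @reach. Qed.

Lemma reach_sym s s' : reach m pr tr eps s s' -> reach m pr tr eps s' s.
Proof.
  destruct coh as [c1 [c2 c3]].
  induction 1 as [|s' y H IH Hy]; [constructor|].
  apply reach_trans with s'; [|exact IH].
  (* Coherence on the degenerate triangle [pr s'], [y], [pr s'] undoes the step. *)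
  assert (E : tr (tr s' y) (pr s') = s').
  { rewrite c3; [apply c2|assumption|now rewrite m_sym|now rewrite m_refl]. }
  rewrite <- E at 2. constructor; [constructor|]. now rewrite c1, m_sym.
Qed.

Lemma reach_unique s s1 s2 : trivial_monodromy m ->
  reach m pr tr eps s s1 -> reach m pr tr eps s s2 -> pr s1 = pr s2 -> s1 = s2.
Proof.
  intros T H1 H2. apply (T S pr tr eps eps_pos coh).
  apply reach_trans with s; [now apply reach_sym|assumption].
Qed.
End Reach.

(** * Separating components in a metric covering *)

Section MetricCovering.
Variables (M X : Type) (e : M -> M -> R) (d : X -> X -> R) (rho : M -> X).
Variables (lft : M -> X -> M) (r0 D : R) (n : nat).
Hypothesis r0_pos : r0 > 0.
Hypothesis D_pos : D > 0.
Hypothesis e_pos : forall x y, 0 <= e x y.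
Hypothesis e_refl : forall x, e x x = 0.
Hypothesis e_sym : forall x y, e x y = e y x.
Hypothesis e_tri : forall x y z, e x z <= e x y + e y z.
Hypothesis rho_lip : forall x y, d (rho x) (rho y) <= e x y.
Hypothesis lft_rho : forall z y, rho (lft z y) = y.
Hypothesis lft_near : forall z y, d (rho z) y < r0 -> e z (lft z y) <= d (rho z) y.
Hypothesis lft_unique : forall z w, e z w < r0 -> lft z (rho w) = w.
Hypothesis e_chain : forall a b eps eta, eps > 0 -> eta > 0 ->
  exists l, chain e eps a b l /\ l < e a b + eta.
Hypothesis d_chain : forall a b eps eta, eps > 0 -> eta > 0 ->
  exists l, chain d eps a b l /\ l < d a b + eta.
Hypothesis d_diam : forall x y, d x y <= D.
Hypothesis e_mono : trivial_monodromy e.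
Hypothesis fiber_bound : forall z l, NoDup l -> (forall w, In w l -> rho w = rho z) ->
  (length l <= n)%nat.

(** * Deck transformations *)

Lemma lft_self z : lft z (rho z) = z.
Proof. apply lft_unique. rewrite e_refl. exact r0_pos. Qed.

(** Two steps shorter than [r0 / 2] stay within [r0] of [z], where lifts are unique. *)
Lemma lft_lft z y y' : d (rho z) y < r0 / 2 -> d y y' < r0 / 2 ->
  lft (lft z y) y' = lft z y'.
Proof.
  intros H H'. symmetry. rewrite <- (lft_rho (lft z y) y') at 1.
  apply lft_unique.
  assert (H1 := lft_near z y). assert (H2 := lft_near (lft z y) y').
  rewrite lft_rho in H2. specialize (H1 ltac:(lra)). specialize (H2 ltac:(lra)).
  assert (H3 := e_tri z (lft z y) (lft (lft z y) y')). lra.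
Qed.

Lemma coherent_lft : coherent d rho lft (r0 / 2).
Proof.
  split; [exact lft_rho|split; [exact lft_self|]].
  intros s y y' H1 H2 _. now apply lft_lft.
Qed.

(* [twin a b w v] will mean v = g w, for g the deck transformation with g a = b. *)
Inductive twin (a b : M) : M -> M -> Prop :=
| twin_refl : twin a b a b
| twin_snoc w v w' : twin a b w v -> e w w' < r0 / 2 -> twin a b w' (lft v (rho w')).

Lemma twin_rho a b w v : rho a = rho b -> twin a b w v -> rho w = rho v.
Proof. intros E H; induction H; [assumption|now rewrite lft_rho]. Qed.

Lemma twin_trans a b a1 b1 a2 b2 :
  twin a b a1 b1 -> twin a1 b1 a2 b2 -> twin a b a2 b2.
Proof. intros H H'; induction H'; eauto using twin. Qed.

Lemma twin_step_near w v w' : rho w = rho v -> e w w' < r0 / 2 ->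
  e v (lft v (rho w')) <= e w w'.
Proof.
  intros E H. assert (H1 := rho_lip w w'). rewrite E in H1.
  assert (H2 := lft_near v (rho w')). lra.
Qed.

Lemma twin_sym a b w v : rho a = rho b -> twin a b w v -> twin w v a b.
Proof.
  intros E H; induction H as [|w v w' H IH Hw]; [constructor|].
  apply twin_trans with w v; [|exact IH].
  assert (Ev := twin_rho _ _ _ _ E H).
  assert (E' : lft (lft v (rho w')) (rho w) = v).
  { rewrite Ev. apply lft_unique. rewrite e_sym.
    assert (H1 := twin_step_near w v w' Ev Hw). lra. }
  rewrite <- E' at 2. apply twin_snoc with w'; [constructor|now rewrite e_sym].
Qed.

Lemma twin_swap a b w v : rho a = rho b -> twin a b w v -> twin b a v w.
Proof.
  intros E H; induction H as [|w v w' H IH Hw]; [constructor|].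
  assert (Ev := twin_rho _ _ _ _ E H).
  assert (H1 := twin_step_near w v w' Ev Hw).
  replace w' with (lft w (rho (lft v (rho w')))) at 2.
  - apply twin_snoc with v; [exact IH|lra].
  - rewrite lft_rho. apply lft_unique. lra.
Qed.

(** The pairs of points in a common fibre form a covering of [M] by first projection, with twin
    steps as transport. Its monodromy along a loop at [a] is trivial. *)
Lemma twin_loop a b v : rho a = rho b -> twin a b a v -> v = b.
Proof.
  intros E H.
  set (S := {wv : M * M | rho (fst wv) = rho (snd wv)}).
  assert (Sext : forall s s' : S, proj1_sig s = proj1_sig s' -> s = s').
  { intros [s Hs] [s' Hs']; simpl; intros <-. f_equal. apply proof_irrelevance. }
  set (pr := fun s : S => fst (proj1_sig s)).
  assert (Htr : forall (s : S) w', rho (fst (w', lft (snd (proj1_sig s)) (rho w'))) =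
    rho (snd (w', lft (snd (proj1_sig s)) (rho w')))).
  { intros s w'. simpl. now rewrite lft_rho. }
  set (tr := fun (s : S) w' =>
    exist (fun wv : M * M => rho (fst wv) = rho (snd wv)) _ (Htr s w') : S).
  assert (coh : coherent e pr tr (r0 / 2)).
  { split; [reflexivity|split].
    - intros [[w u] Hs]; apply Sext; simpl in *. unfold pr; simpl.
      now rewrite Hs, lft_self.
    - intros [[w u] Hs] y y'; unfold pr, tr; simpl in *; intros H1 H2 H3.
      apply Sext; simpl. f_equal. apply lft_lft.
      + rewrite <- Hs. assert (H4 := rho_lip w y). lra.
      + assert (H4 := rho_lip y y'). lra. }
  set (s0 := exist (fun wv : M * M => rho (fst wv) = rho (snd wv)) (a, b) E : S).
  assert (Hreach : forall w u, twin a b w u -> exists s : S,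
    proj1_sig s = (w, u) /\ reach e pr tr (r0 / 2) s0 s).
  { intros w u Hu; induction Hu as [|w u w' Hu [s [Hs IH]] Hw].
    - exists s0; split; [reflexivity|constructor].
    - exists (tr s w'); split; [simpl; now rewrite Hs|].
      constructor; [exact IH|]. unfold pr; now rewrite Hs. }
  destruct (Hreach a v H) as [s [Hs R]].
  assert (Q : s0 = s).
  { apply (e_mono S pr tr (r0 / 2)); try assumption; [lra|].
    unfold pr; now rewrite Hs. }
  subst s. simpl in Hs. congruence.
Qed.

Lemma twin_unique a b w v v' : rho a = rho b -> twin a b w v -> twin a b w v' -> v = v'.
Proof.
  intros E H H'. symmetry. apply (twin_loop w).
  - now apply (twin_rho a b).
  - apply twin_trans with a b; [now apply twin_sym|assumption].
Qed.

Lemma twin_chain a b w w' v l : rho a = rho b -> twin a b w v ->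
  chain e (r0 / 2) w w' l -> exists v', twin a b w' v' /\ e v v' <= l.
Proof.
  intros E H C; induction C as [|u u' l C [v' [IH1 IH2]] Hu].
  - exists v; split; [assumption|rewrite e_refl; lra].
  - exists (lft v' (rho u')); split; [now constructor 2 with u|].
    assert (H1 := twin_step_near u v' u' (twin_rho _ _ _ _ E IH1) Hu).
    assert (H2 := e_tri v v' (lft v' (rho u'))). lra.
Qed.

Lemma twin_total a b w : rho a = rho b -> exists v, twin a b w v.
Proof.
  intros E. destruct (e_chain a w (r0 / 2) 1) as [l [C _]]; [lra|lra|].
  destruct (twin_chain a b a w b l E (twin_refl a b) C) as [v [H _]]. now exists v.
Qed.

(** An almost shortest chain from [w] to [w'] is carried along step by step, and no step gets
    longer. *)
Lemma twin_nonexpanding a b w v w' v' : rho a = rho b -> twin a b w v -> twin a b w' v' ->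
  e v v' <= e w w'.
Proof.
  intros E H H'. apply Rnot_lt_le. intros L.
  destruct (e_chain w w' (r0 / 2) (e v v' - e w w')) as [l [C Hl]]; [lra|lra|].
  destruct (twin_chain a b w w' v l E H C) as [u [Hu Hl']].
  rewrite (twin_unique a b w' v' u E H' Hu) in *. lra.
Qed.

(** Totality and uniqueness turn [twin a b] and [twin b a] into functions [g] and [h]. They are
    mutually inverse by [twin_swap], and both are nonexpanding, hence isometries. *)
Lemma deck_transformation a b : rho a = rho b -> exists g h : M -> M,
  g a = b /\ (forall x y, e (g x) (g y) = e x y) /\ (forall x, rho (g x) = rho x) /\
  (forall x, g (h x) = x) /\ (forall x, h (g x) = x).
Proof.
  intros E.
  assert (C : forall a b, rho a = rho b -> exists g : M -> M, forall w, twin a b w (g w)).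
  { intros a' b' E'.
    exists (fun w => proj1_sig (constructive_indefinite_description _ (twin_total a' b' w E'))).
    intros w. apply proj2_sig. }
  destruct (C a b E) as [g Hg]. destruct (C b a (eq_sym E)) as [h Hh].
  assert (gh : forall x, g (h x) = x).
  { intros x. apply (twin_unique a b (h x)); [assumption|apply Hg|].
    now apply twin_swap. }
  assert (hg : forall x, h (g x) = x).
  { intros x. apply (twin_unique b a (g x)); [now symmetry|apply Hh|].
    now apply twin_swap. }
  exists g, h. repeat split; auto.
  - apply (twin_unique a b a); [assumption|apply Hg|constructor].
  - intros x y. apply Rle_antisym.
    + now apply (twin_nonexpanding a b).
    + rewrite <- (hg x), <- (hg y) at 1.
      apply (twin_nonexpanding b a); auto.
  - intros x. symmetry. now apply (twin_rho a b).
Qed.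

(** * Balls, dense fibres and separating components *)

Lemma chain_dist eps a b l : chain e eps a b l -> e a b <= l.
Proof.
  induction 1 as [|b c l H IH Hbc]; [rewrite e_refl; lra|].
  assert (H1 := e_tri a b c). lra.
Qed.

(** A chain from [a] of length below [rad] cannot leave the ball, since its initial pieces are no
    longer than the whole. *)
Lemma ball_linked eps a b rad : eps > 0 -> e a b < rad ->
  linked e eps (fun x => e a x < rad) a b.
Proof.
  intros He Hrad. destruct (e_chain a b eps (rad - e a b)) as [l [C Hl]]; [lra|lra|].
  assert (Hl' : l < rad) by lra. clear Hrad Hl.
  induction C as [|b c l C IH Hbc].
  - constructor. now rewrite e_refl.
  - assert (H0 := e_pos b c). assert (H1 := chain_dist _ _ _ _ C).
    assert (H2 := e_tri a b c).
    apply linked_snoc with b; [apply IH| |assumption]; lra.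
Qed.

Lemma all_linked eps a b : eps > 0 -> linked e eps (fun _ => True) a b.
Proof.
  intros He. apply linked_sub with (fun x => e a x < e a b + 1); [trivial|].
  apply ball_linked; lra.
Qed.

(** Lift to [b] an almost shortest chain of [X] from [rho b] to [rho a]; the lift is no longer and
    ends in the fibre of [a]. *)
Lemma fiber_dense a b eta : eta > 0 -> exists a', rho a' = rho a /\ e a' b < D + eta.
Proof.
  intros Heta. destruct (d_chain (rho b) (rho a) r0 eta) as [l [C Hl]]; [lra|lra|].
  assert (H : exists w, rho w = rho a /\ e b w <= l).
  { clear Hl. induction C as [|y y' l C [w [Hw IH]] Hy].
    - exists b. split; [reflexivity|rewrite e_refl; lra].
    - exists (lft w y'). split; [apply lft_rho|].
      assert (H1 := lft_near w y'). rewrite Hw in H1.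
      assert (H2 := e_tri b w (lft w y')). specialize (H1 Hy). lra. }
  destruct H as [w [Hw H]]. exists w. split; [exact Hw|].
  rewrite e_sym. assert (H1 := d_diam (rho b) (rho a)). lra.
Qed.

(* The mod 2 number of crossings from {e p < r} to a component C of the band is
   a cocycle, hence depends only on the endpoints. It is 1 for a chain from p to q
   that leaves the ball through C and never comes back, so it cannot vanish. *)
Lemma separating_component p q r eps : eps > 0 -> r > 0 -> r + eps <= e p q ->
  exists y, r <= e p y < r + eps /\
    ~ linked e eps (fun x => ~ linked e eps (fun x => r <= e p x < r + eps) y x) p q.
Proof.
  intros He Hr Hq.
  (* Walk from [q] to [p] and stop on entering the ball at [x]; the preceding point [y] lies in the
     band. *)
  destruct (linked_first_hit e eps (fun _ => True) (fun x => e p x < r) q p)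
    as [y [x [Hqy [Hyx [_ Hx]]]]].
  { now apply all_linked. }
  { now rewrite e_refl. }
  { lra. }
  assert (Hy : r <= e p y < r + eps).
  { apply linked_in in Hqy. destruct Hqy as [_ [_ Hy]].
    assert (H1 := e_tri p x y). rewrite (e_sym x y) in H1. lra. }
  exists y. split; [exact Hy|]. intros Hpq.
  set (B := fun x => r <= e p x < r + eps) in *.
  set (C := linked e eps B y) in *.
  set (U := fun x => e p x < r).
  assert (CB : forall u, C u -> B u) by (intros u Hu; now apply linked_in in Hu).
  assert (UC : forall u, U u -> C u -> False).
  { intros u H1 H2. apply CB in H2. unfold U, B in *. lra. }
  assert (UBC : forall u v w, U u -> C v -> e u w < eps -> e v w < eps -> U w \/ C w).
  { intros u v w Hu Hv Huw Hvw. destruct (Rlt_le_dec (e p w) r) as [H|H]; [now left|right].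
    apply linked_snoc with v; [assumption| |assumption].
    unfold B, U in *. assert (H1 := e_tri p u w). lra. }
  set (cross := fun u v => (U u /\ C v) \/ (C u /\ U v)).
  set (chi := fun u v => if excluded_middle_informative (cross u v) then true else false).
  assert (chi0 : forall u v, ~ cross u v -> chi u v = false).
  { intros u v H. unfold chi. now destruct excluded_middle_informative. }
  (* The double cover with transition function [chi]; its coherence is the cocycle condition on
     triples of points at mutual distance below [eps]. *)
  set (tr := fun (s : M * bool) v => (v, xorb (snd s) (chi (fst s) v))).
  assert (coh : coherent e fst tr eps).
  { split; [reflexivity|split].
    - intros [u b]; unfold tr; simpl. rewrite chi0, Bool.xorb_false_r; [reflexivity|].
      unfold cross. intros [[H1 H2]|[H1 H2]]; eauto.
    - intros [u b] v w Huv Hvw Huw; unfold tr; simpl in *.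
      rewrite Bool.xorb_assoc. do 2 f_equal.
      set (I := fun z => z = u \/ z = v \/ z = w).
      assert (close : forall a b, I a -> I b -> e a b < eps).
      { intros a b' [->|[->| ->]] [->|[->| ->]]; rewrite ?e_refl; auto;
          now rewrite e_sym. }
      (* On such a triple [chi] is a coboundary. If the triple has a crossing, all its points lie in
         [U] or [C] by [UBC], and [c] is the indicator of [U]; otherwise [chi] vanishes on it. *)
      assert (K : exists c, forall a b, I a -> I b -> chi a b = xorb (c a) (c b)).
      { destruct (classic (exists a b, I a /\ I b /\ U a /\ C b))
          as [[a0 [b0 [Ia0 [Ib0 [Ua0 Cb0]]]]]|N].
        - exists (fun z => if excluded_middle_informative (U z) then true else false).
          intros a b' Ia Ib.
          assert (Ha := UBC a0 b0 a Ua0 Cb0 (close _ _ Ia0 Ia) (close _ _ Ib0 Ia)).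
          assert (Hb := UBC a0 b0 b' Ua0 Cb0 (close _ _ Ia0 Ib) (close _ _ Ib0 Ib)).
          assert (Na := UC a). assert (Nb := UC b').
          unfold chi, cross.
          repeat destruct excluded_middle_informative; simpl; try reflexivity; exfalso; tauto.
        - exists (fun _ => false). intros a b' Ia Ib. apply chi0.
          intros [[H1 H2]|[H1 H2]]; apply N; [exists a, b'|exists b', a]; auto. }
      destruct K as [c Hc].
      rewrite !Hc by (unfold I; auto).
      destruct (c u), (c v), (c w); reflexivity. }
  assert (T : forall S a b, (forall u v, S u -> S v -> ~ cross u v) ->
    linked e eps S a b -> forall beta, reach e fst tr eps (a, beta) (b, beta)).
  { intros S a b HS HL beta. induction HL as [|b c HL IH Hc Hbc]; [constructor|].
    apply linked_in in HL.
    replace (c, beta) with (tr (b, beta) c).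
    - now constructor.
    - unfold tr; simpl. rewrite chi0, Bool.xorb_false_r; [reflexivity|].
      apply HS; tauto. }
  assert (R1 : reach e fst tr eps (p, false) (q, false)).
  { refine (T _ _ _ _ Hpq false). intros u v H1 H2. unfold cross. tauto. }
  assert (R2 : reach e fst tr eps (p, false) (q, true)).
  { apply reach_trans with (x, false).
    { apply T with U; [|now apply ball_linked].
      intros u v H1 H2 [[_ H]|[H _]]; eauto. }
    apply reach_trans with (y, true).
    - replace (y, true) with (tr (x, false) y).
      + constructor; [constructor|]. simpl. now rewrite e_sym.
      + unfold tr; simpl. unfold chi. destruct excluded_middle_informative as [|N]; [reflexivity|].
        exfalso; apply N. left. split; [exact Hx|now constructor].
    - apply T with (fun z => True /\ ~ U z); [|now apply linked_sym].
      intros u v [_ H1] [_ H2]. unfold cross. tauto. }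
  assert (Q := reach_unique M (M * bool) e fst tr eps e_sym e_refl He coh
    (p, false) _ _ e_mono R1 R2 eq_refl).
  discriminate Q.
Qed.

(** Only lower bounds for cardinalities are recorded, so components can be compared before their
    counts are known. *)
Definition many (F A : M -> Prop) (k : nat) : Prop :=
  exists l, NoDup l /\ length l = k /\ forall x, In x l -> F x /\ A x.

(* Move C by a deck transformation g to a set gC inside the component U of p.
   Some component A of the complement of C has its image gA inside U as well, and
   gA misses the point g c0 of U. *)
Lemma deck_component_grows (C : M -> Prop) c0 p q rad eta eps :
  eps > 0 -> eta > 0 -> C c0 ->
  (forall c, C c -> linked e eps C c0 c) ->
  (forall c, C c -> rad <= e p c) ->
  (forall c, C c -> e c0 c + (D + eta) < rad) ->
  ~ linked e eps (fun x => ~ C x) p q ->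
  exists a, (a = p \/ a = q) /\ forall k,
    many (fun z => rho z = rho c0) (linked e eps (fun x => ~ C x) a) k ->
    many (fun z => rho z = rho c0) (linked e eps (fun x => ~ C x) p) (S k).
Proof.
  intros He Heta Hc0 Cconn Cp Cdiam Hpq.
  destruct (fiber_dense c0 p eta Heta) as [b [Hb Hbp]].
  destruct (deck_transformation c0 b (eq_sym Hb)) as [g [h [gc0 [giso [grho [gh hg]]]]]].
  assert (hiso : forall x y, e (h x) (h y) = e x y).
  { intros x y. now rewrite <- giso, !gh. }
  set (gC := fun x => C (h x)).
  (* [gC] has radius below [rad - (D + eta)] around [b], so it fits into the ball of radius [rad]
     about [p], which misses [C]. *)
  assert (gCU : forall x, gC x -> linked e eps (fun x => ~ C x) p x).
  { intros x Hx. apply linked_sub with (fun z => e p z < rad).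
    - intros z Hz Cz. apply Cp in Cz. lra.
    - apply ball_linked; [assumption|].
      assert (H1 := Cdiam _ Hx). rewrite <- (giso c0 (h x)), gc0, gh in H1.
      assert (H2 := e_tri p b x). rewrite (e_sym p b) in H2. lra. }
  assert (Hgc0 : gC b) by (unfold gC; now rewrite <- gc0, hg).
  assert (disj : forall x, gC x -> ~ C x).
  { intros x Hx. apply gCU in Hx. now apply linked_in in Hx. }
  (* If [g p] and [g q] both reached [c0] off [gC], applying [h] would link [p] to [q] off [C]. *)
  assert (Ha : exists a, (a = p \/ a = q) /\ ~ linked e eps (fun x => ~ gC x) (g a) c0).
  { apply NNPP. intros N. apply Hpq.
    assert (H : linked e eps (fun x => ~ gC x) (g p) (g q)).
    { apply linked_trans with c0; [|apply linked_sym; [assumption|]];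
      apply NNPP; intros H; apply N; [exists p|exists q]; auto. }
    apply (linked_map e e eps (fun x => ~ gC x) (fun x => ~ C x) h) in H.
    - now rewrite !hg in H.
    - exact hiso.
    - trivial. }
  destruct Ha as [a [Hapq Ha]]. exists a. split; [exact Hapq|].
  assert (gA : forall x, linked e eps (fun x => ~ C x) a x ->
    linked e eps (fun x => ~ C x) p (g x)).
  { intros x Hx.
    apply (linked_map e e eps (fun x => ~ C x) (fun x => ~ gC x) g) in Hx;
      [|assumption|intros z Hz; unfold gC; now rewrite hg].
    set (y := g x) in *.
    (* All of [C] avoids [gC] and is linked to [c0], which [g a] cannot reach off [gC]. *)
    assert (HCy : ~ C y).
    { intros Cy. apply Ha. apply linked_trans with y; [exact Hx|].
      apply linked_sub with C; [intros z Hz Gz; now apply (disj z)|].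
      apply linked_sym; auto. }
    (* Walk from [y] towards [b] until [gC] or [C] is met. Meeting [gC] leads into the component of
       [p]; meeting [C] would again link [g a] to [c0]. *)
    destruct (linked_first_hit e eps (fun _ => True) (fun z => gC z \/ C z) y b)
      as [u [v [Hyu [Huv [_ [Hv|Hv]]]]]].
    - now apply all_linked.
    - now left.
    - apply linked_in in Hx. tauto.
    - apply linked_trans with v; [now apply gCU|].
      apply linked_sym; [assumption|]. apply linked_snoc with u; [|now apply disj|assumption].
      revert Hyu. apply linked_sub. tauto.
    - exfalso. apply Ha. apply linked_trans with y; [exact Hx|].
      apply linked_trans with v.
      + apply linked_snoc with u; [|intros Gv; now apply (disj v)|assumption].
        revert Hyu. apply linked_sub. tauto.
      + apply linked_sub with C; [intros z Hz Gz; now apply (disj z)|].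
        apply linked_sym; auto. }
  intros k [l [Nl [Ll Hl]]].
  (* The new point [b] equals [g c0] with [c0] in [C], so it is not the image of a point off [C]. *)
  exists (b :: map g l). split; [|split].
  - constructor.
    + rewrite in_map_iff. intros [x [Hx Ix]]. apply Hl in Ix. destruct Ix as [_ Ix].
      apply linked_in in Ix. apply (proj2 Ix). rewrite <- (hg x), Hx. exact Hgc0.
    + apply FinFun.Injective_map_NoDup; [|assumption].
      intros x y H. now rewrite <- (hg x), <- (hg y), H.
  - simpl. now rewrite length_map, Ll.
  - intros x [<-|Ix]; [split; auto|].
    apply in_map_iff in Ix. destruct Ix as [z [<- Iz]]. apply Hl in Iz.
    rewrite grho. split; [tauto|]. now apply gA.
Qed.

(** Were [C] narrower, [deck_component_grows] would apply from [p] and from [q], and some component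
    would contain arbitrarily many points of one fibre, against [fiber_bound]. *)
Lemma separator_is_wide (C : M -> Prop) c0 p q rad eta eps :
  eps > 0 -> eta > 0 -> C c0 ->
  (forall c, C c -> linked e eps C c0 c) ->
  (forall c, C c -> rad <= e p c) -> (forall c, C c -> rad <= e q c) ->
  ~ linked e eps (fun x => ~ C x) p q ->
  exists c, C c /\ rad - (D + eta) <= e c0 c.
Proof.
  intros He Heta Hc0 Cconn Cp Cq Hpq. apply NNPP. intros N.
  assert (Cdiam : forall c, C c -> e c0 c + (D + eta) < rad).
  { intros c Hc. apply Rnot_le_lt. intros L. apply N. exists c. split; [assumption|lra]. }
  destruct (deck_component_grows C c0 p q rad eta eps) as [a [Ha Hgrow]]; auto.
  destruct (deck_component_grows C c0 q p rad eta eps) as [a' [Ha' Hgrow']]; auto.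
  { intros H. apply Hpq. now apply linked_sym. }
  set (F := fun z => rho z = rho c0) in *.
  set (U := fun a => linked e eps (fun x => ~ C x) a) in *.
  assert (nil0 : forall A, many F A 0).
  { intros A. exists nil. repeat split; [constructor|destruct H..]. }
  assert (unbounded : forall u,
    (forall k, many F (U u) k -> exists k', (k < k')%nat /\ many F (U u) k') -> False).
  { intros u H.
    assert (H' : forall k, exists k', (k <= k')%nat /\ many F (U u) k').
    { induction k as [|k [k' [Hk IH]]]; [exists O; auto|].
      destruct (H k' IH) as [k'' [H1 H2]]. exists k''. split; [lia|assumption]. }
    destruct (H' (S n)) as [k [Hk [l [Nl [Ll Hl]]]]].
    assert (H1 := fiber_bound c0 l Nl (fun w Hw => proj1 (Hl w Hw))). lia. }
  destruct Ha as [->| ->].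
  { apply (unbounded p). eauto. }
  destruct Ha' as [->| ->].
  { apply (unbounded q). eauto. }
  (* The mixed case: a count for [p] passes to [q] and back, growing by one each way. *)
  apply (unbounded p). intros k Hk. exists (S (S k)). auto.
Qed.

(** * Fibre points in the bands and the counting bound *)

Lemma linked_intermediate eps (C : M -> Prop) c0 c t : 0 <= t -> 0 < eps ->
  linked e eps C c0 c -> t <= e c0 c -> exists x, C x /\ t <= e c0 x < t + eps.
Proof.
  intros Ht He H. induction H as [H | b c H IH Hc Hbc]; intros L.
  - exists c0. rewrite e_refl in *. split; [assumption|lra].
  - destruct (Rle_lt_dec t (e c0 b)); [now apply IH|].
    exists c. assert (H1 := e_tri c0 b c). split; [assumption|lra].
Qed.

(** The separating component is taken at the middle radius of band [j]. Enlarging [D] to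
    [D + 2 * eps] absorbs both the thickness of the component and the error in [fiber_dense], which
    keeps the inequalities strict. *)
Lemma band_points p q m j eps : eps > 0 -> (j < m)%nat ->
  2 * INR m * (D + 2 * eps) + eps <= e p q ->
  exists l, NoDup l /\ length l = S (Nat.min j (m - 1 - j)) /\
    forall o, In o l -> rho o = rho p /\
      2 * INR j * (D + 2 * eps) < e p o < 2 * INR (S j) * (D + 2 * eps).
Proof.
  intros He Hj Hpq. set (D2 := D + 2 * eps) in *.
  assert (HD2 : D2 > 0) by (unfold D2; lra).
  set (r := (2 * INR j + 1) * D2). set (k := Nat.min j (m - 1 - j)).
  assert (Hj0 := pos_INR j). assert (Hk0 := pos_INR k).
  assert (Hjk : INR k <= INR j) by (apply le_INR; lia).
  assert (Hmk : INR j + INR k + 1 <= INR m).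
  { rewrite <- plus_INR, <- S_INR. apply le_INR. lia. }
  destruct (separating_component p q r eps) as [c0 [Hc0 Hsep]].
  { assumption. } { unfold r. nra. } { unfold r. nra. }
  set (B := fun x => r <= e p x < r + eps) in *.
  set (C := linked e eps B c0) in *.
  assert (CB : forall u, C u -> B u) by (intros u Hu; now apply linked_in in Hu).
  assert (Cin : forall c, C c -> linked e eps C c0 c).
  { intros c Hc. induction Hc as [|b c Hb IH Hc Hbc].
    - constructor. now constructor.
    - apply linked_snoc with b; [assumption| |assumption].
      now apply linked_snoc with b. }
  (* The radius [(2k+1) * D2] is safe for [p] because [k <= j], and for [q] because
     [j + k + 1 <= m]. *)
  destruct (separator_is_wide C c0 p q ((2 * INR k + 1) * D2) eps eps)
    as [c1 [Hc1 Hwide]]; auto.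
  { now constructor. }
  { intros c Hc. apply CB in Hc. unfold B, r in Hc. nra. }
  { intros c Hc. apply CB in Hc. unfold B, r in Hc.
    assert (H1 := e_tri p c q). rewrite (e_sym c q) in H1. nra. }
  (* The next point is found near a point of [C] at distance about [2 * i * D2] from [c0]. It is
     farther than [(2i-1) * D2] from [c0], hence differs from all earlier ones. *)
  assert (H : forall i, (i <= S k)%nat -> exists l, NoDup l /\ length l = i /\
    forall o, In o l -> rho o = rho p /\
      2 * INR j * D2 < e p o < 2 * INR (S j) * D2 /\ e c0 o < (2 * INR i - 1) * D2).
  { induction i as [|i IH]; intros Hi.
    { exists nil. repeat split; [constructor|destruct H..]. }
    destruct IH as [l [Nl [Ll Hl]]]; [lia|].
    assert (Hik : INR i <= INR k) by (apply le_INR; lia).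
    assert (Hi0 := pos_INR i).
    destruct (linked_intermediate eps C c0 c1 (2 * INR i * D2)) as [x [Hx Hxi]]; auto.
    { nra. } { unfold D2 in *. nra. }
    destruct (fiber_dense p x eps He) as [o [Ho Hox]].
    apply CB in Hx. unfold B, r in Hx.
    assert (H1 := e_tri p o x). assert (H2 := e_tri p x o).
    assert (H3 := e_tri c0 o x). assert (H4 := e_tri c0 x o).
    rewrite (e_sym x o) in *. rewrite !S_INR.
    exists (o :: l). split; [|split].
    - constructor; [|assumption]. intros Io. apply Hl in Io. unfold D2 in *. nra.
    - simpl. now rewrite Ll.
    - intros o' [<-|Io].
      + split; [assumption|]. unfold D2 in *. split; nra.
      + apply Hl in Io. rewrite S_INR in Io. destruct Io as [Io1 [Io2 Io3]].
        split; [assumption|split; [assumption|nra]]. }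
  destruct (H (S k) (le_n _)) as [l [Nl [Ll Hl]]].
  exists l. split; [assumption|split; [assumption|]].
  intros o Ho. apply Hl in Ho. tauto.
Qed.

Fixpoint band_count (m j : nat) : nat :=
  match j with
  | O => O
  | S j' => band_count m j' + S (Nat.min j' (m - 1 - j'))
  end.

Lemma band_count_total m : (S m * S m <= 4 * band_count m m + 1)%nat.
Proof.
  (* Up to the middle the count is a triangular number; beyond it, the terms still missing add up to
     the triangular number of [m - j]. The [+ 1] in the result is needed for odd squares. *)
  assert (H : forall j, (j <= m)%nat ->
    ((2 * j <= m + 1)%nat -> (2 * band_count m j = j * (j + 1))%nat) /\
    ((m <= 2 * j)%nat ->
      (S m * S m <= 4 * band_count m j + 1 + 2 * ((m - j) * (m - j + 1)))%nat)).
  { induction j as [|j IH]; intros Hj; simpl band_count.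
    - split; [reflexivity|]. intros H0. replace m with 0%nat by lia. simpl. lia.
    - destruct (IH ltac:(lia)) as [IH1 IH2]. split; intros H0.
      + rewrite Nat.min_l by lia. nia.
      + destruct (Nat.le_gt_cases m (2 * j)).
        * rewrite Nat.min_r by lia. specialize (IH2 H).
          replace (m - j)%nat with (S (m - S j)) in IH2 by lia.
          replace (m - 1 - j)%nat with (m - S j)%nat by lia. nia.
        * rewrite Nat.min_l by lia. specialize (IH1 ltac:(lia)).
          assert (Hm : (m = 2 * j + 1 \/ m = 2 * j + 2)%nat) by lia.
          destruct Hm as [-> | ->].
          -- replace (2 * j + 1 - S j)%nat with j by lia. nia.
          -- replace (2 * j + 2 - S j)%nat with (j + 1)%nat by lia. nia. }
  destruct (H m (le_n m)) as [_ H']. rewrite Nat.sub_diag in H'. lia.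
Qed.

(** The point [p] and the points in the [m] bands are distinct and share a fibre, so
    [n >= 1 + band_count m m]; [band_count_total] turns this into the term [+ 3]. *)
Lemma dist_fiber_bound p q m : 2 * INR m * D < e p q -> (S m * S m + 3 <= 4 * n)%nat.
Proof.
  intros Hpq.
  assert (Hm := pos_INR m).
  (* The solution of [2 * m * (D + 2 * eps) + eps = e p q], the extreme case allowed in
     [band_points]. *)
  set (eps := (e p q - 2 * INR m * D) / (4 * INR m + 1)).
  assert (He : eps > 0) by (apply Rdiv_lt_0_compat; lra).
  assert (Heq : 2 * INR m * (D + 2 * eps) + eps = e p q) by (unfold eps; field; lra).
  assert (HD2 : D + 2 * eps > 0) by lra.
  assert (H : forall j, (j <= m)%nat -> exists l, NoDup l /\
    length l = S (band_count m j) /\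
    forall o, In o l -> rho o = rho p /\ e p o <= 2 * INR j * (D + 2 * eps)).
  { induction j as [|j IH]; intros Hj.
    - exists (p :: nil). split; [|split].
      + repeat constructor. simpl; tauto.
      + reflexivity.
      + intros o [<-|[]]. rewrite e_refl. simpl. split; [reflexivity|lra].
    - destruct IH as [l [Nl [Ll Hl]]]; [lia|].
      destruct (band_points p q m j eps) as [l' [Nl' [Ll' Hl']]]; [assumption|lia|lra|].
      exists (l ++ l'). split; [|split].
      + apply NoDup_app; [assumption..|].
        intros o Ho Ho'. apply Hl in Ho. apply Hl' in Ho'. lra.
      + rewrite length_app, Ll, Ll'. reflexivity.
      + intros o Ho. apply in_app_iff in Ho. destruct Ho as [Ho|Ho].
        * apply Hl in Ho. split; [tauto|]. rewrite S_INR. nra.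
        * apply Hl' in Ho. split; [tauto|lra]. }
  destruct (H m (le_n m)) as [l [Nl [Ll Hl]]].
  assert (H1 := fiber_bound p l Nl (fun w Hw => proj1 (Hl w Hw))).
  assert (H2 := band_count_total m). lia.
Qed.

End MetricCovering.

(** * Paths, homotopies and continuation along them *)

(** Packages pointwise radii as the gauge taken by the compactness lemmas of Coquelicot. *)
Lemma posreal_choice {T : Type} (P : T -> R -> Prop) :
  (forall t, exists delta, delta > 0 /\ P t delta) ->
  exists f : T -> posreal, forall t, P t (f t).
Proof.
  intros H.
  assert (H' : forall t, exists delta : posreal, P t delta).
  { intros t. destruct (H t) as [delta [Hd HP]]. now exists (mkposreal delta Hd). }
  exists (fun t => proj1_sig (constructive_indefinite_description _ (H' t))).
  intros t. apply proj2_sig.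
Qed.

(** A Lebesgue number argument. The gauge is half the given radius, so that it controls both [s] and
    a nearby [s']. *)
Lemma unit_uniform (Q : R -> R -> Prop) :
  (forall t, unitI t -> exists delta, delta > 0 /\ forall s s', unitI s -> unitI s' ->
     Rabs (s - t) < delta -> Rabs (s' - t) < delta -> Q s s') ->
  exists delta, delta > 0 /\ forall s s', unitI s -> unitI s' ->
     Rabs (s - s') < delta -> Q s s'.
Proof.
  intros H.
  destruct (posreal_choice (fun t delta => unitI t -> forall s s', unitI s -> unitI s' ->
     Rabs (s - t) < 2 * delta -> Rabs (s' - t) < 2 * delta -> Q s s')) as [f Hf].
  { intros t. destruct (classic (unitI t)) as [Ht|Ht].
    - destruct (H t Ht) as [delta [Hd HQ]]. exists (delta / 2). split; [lra|].
      intros _ s s' Hs Hs' H1 H2. apply HQ; auto; lra.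
    - exists 1. split; [lra|tauto]. }
  destruct (compactness_value_1d 0 1 f) as [delta Hd].
  exists delta. split; [apply cond_pos|]. intros s s' Hs Hs' Hss.
  apply NNPP. intros N. apply (Hd s Hs). intros [t [Ht [H1 H2]]]. apply N.
  apply (Hf t Ht); auto.
  - assert (H3 := cond_pos (f t)). lra.
  - replace (s' - t) with ((s - t) - (s - s')) by ring.
    assert (H3 := Rabs_triang (s - t) (- (s - s'))). rewrite Rabs_Ropp in H3.
    unfold Rminus at 1. lra.
Qed.

Lemma unit_uniform2 (Q : R -> R -> R -> R -> Prop) :
  (forall u v, unitI u -> unitI v -> exists delta, delta > 0 /\
     forall s t s' t', unitI s -> unitI t -> unitI s' -> unitI t' ->
     Rabs (s - u) < delta -> Rabs (t - v) < delta ->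
     Rabs (s' - u) < delta -> Rabs (t' - v) < delta -> Q s t s' t') ->
  exists delta, delta > 0 /\
     forall s t s' t', unitI s -> unitI t -> unitI s' -> unitI t' ->
     Rabs (s - s') < delta -> Rabs (t - t') < delta -> Q s t s' t'.
Proof.
  intros H.
  destruct (posreal_choice (fun uv delta => unitI (fst uv) -> unitI (snd uv) ->
     forall s t s' t', unitI s -> unitI t -> unitI s' -> unitI t' ->
     Rabs (s - fst uv) < 2 * delta -> Rabs (t - snd uv) < 2 * delta ->
     Rabs (s' - fst uv) < 2 * delta -> Rabs (t' - snd uv) < 2 * delta ->
     Q s t s' t')) as [f Hf].
  { intros [u v]; simpl. destruct (classic (unitI u /\ unitI v)) as [[Hu Hv]|Huv].
    - destruct (H u v Hu Hv) as [delta [Hd HQ]]. exists (delta / 2). split; [lra|].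
      intros _ _ s t s' t' ? ? ? ? H1 H2 H3 H4. apply HQ; auto; lra.
    - exists 1. split; [lra|tauto]. }
  destruct (compactness_value_2d 0 1 0 1 (fun u v => f (u, v))) as [delta Hd].
  exists delta. split; [apply cond_pos|]. intros s t s' t' Hs Ht Hs' Ht' Hss Htt.
  apply NNPP. intros N. apply (Hd s t Hs Ht). intros [u [v [Hu [Hv [H1 [H2 H3]]]]]]. apply N.
  assert (H4 := cond_pos (f (u, v))).
  apply (Hf (u, v) Hu Hv); auto; simpl; try lra.
  - replace (s' - u) with ((s - u) + - (s - s')) by ring.
    assert (H5 := Rabs_triang (s - u) (- (s - s'))). rewrite Rabs_Ropp in H5. lra.
  - replace (t' - v) with ((t - v) + - (t - t')) by ring.
    assert (H5 := Rabs_triang (t - v) (- (t - t'))). rewrite Rabs_Ropp in H5. lra.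
Qed.

(** * Grids on the unit interval and operations on paths *)

Definition grid (N i : nat) : R := INR i / INR N.

Lemma grid_0 N : grid N 0 = 0.
Proof. unfold grid. simpl. lra. Qed.

Lemma grid_N N : (0 < N)%nat -> grid N N = 1.
Proof. intros H. apply lt_0_INR in H. unfold grid. field. lra. Qed.

Lemma grid_unit N i : (0 < N)%nat -> (i <= N)%nat -> unitI (grid N i).
Proof.
  intros H Hi. apply lt_0_INR in H. apply le_INR in Hi. assert (H0 := pos_INR i).
  unfold unitI, grid. split.
  - apply Rmult_le_pos; [assumption|]. left. now apply Rinv_0_lt_compat.
  - apply Rmult_le_reg_r with (INR N); [assumption|]. field_simplify; lra.
Qed.

Lemma grid_le N i : (0 < N)%nat -> grid N i <= grid N (S i).
Proof.
  intros H. apply lt_0_INR in H. unfold grid. rewrite S_INR.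
  apply Rmult_le_compat_r; [left; now apply Rinv_0_lt_compat|lra].
Qed.

Lemma grid_step N i : (0 < N)%nat -> grid N (S i) - grid N i = / INR N.
Proof. intros H. apply lt_0_INR in H. unfold grid. rewrite S_INR. field. lra. Qed.

Lemma mesh delta : delta > 0 -> exists N0, (0 < N0)%nat /\
  forall N, (N0 <= N)%nat -> forall i, Rabs (grid N i - grid N (S i)) < delta.
Proof.
  intros Hd. destruct (archimed_cor1 delta Hd) as [N0 [H1 H2]].
  exists N0. split; [assumption|]. intros N HN i.
  rewrite Rabs_minus_sym, grid_step by lia.
  assert (H3 : 0 < INR N0) by now apply lt_0_INR.
  assert (H4 : INR N0 <= INR N) by now apply le_INR.
  rewrite Rabs_right.
  - apply Rle_lt_trans with (/ INR N0); [|assumption].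
    apply Rinv_le_contravar; assumption.
  - apply Rle_ge. left. apply Rinv_0_lt_compat. lra.
Qed.

(** Connectedness of the interval, used as induction along a fine grid of [[0, t]]. *)
Lemma unit_propagate (P : R -> Prop) : P 0 ->
  (forall t, unitI t -> exists delta, delta > 0 /\ forall s s', unitI s -> unitI s' ->
     Rabs (s - t) < delta -> Rabs (s' - t) < delta -> P s -> P s') ->
  forall t, unitI t -> P t.
Proof.
  intros H0 H. destruct (unit_uniform (fun s s' => P s -> P s') H) as [delta [Hd HP]].
  intros t Ht. destruct (mesh delta Hd) as [N [HN Hmesh]].
  assert (Hi : forall i, (i <= N)%nat -> P (grid N i * t)).
  { induction i as [|i IH]; intros Hi.
    - now rewrite grid_0, Rmult_0_l.
    - apply HP with (grid N i * t).
      + destruct (grid_unit N i HN ltac:(lia)). unfold unitI in *. nra.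
      + destruct (grid_unit N (S i) HN Hi). unfold unitI in *. nra.
      + rewrite <- Rmult_minus_distr_r, Rabs_mult.
        assert (Hm := Hmesh N (le_n N) i).
        assert (Ht' : Rabs t <= 1) by (rewrite Rabs_right; unfold unitI in Ht; lra).
        assert (H1 := Rabs_pos t). assert (H2 := Rabs_pos (grid N i - grid N (S i))). nra.
      + apply IH. lia. }
  specialize (Hi N (le_n N)). now rewrite grid_N, Rmult_1_l in Hi by assumption.
Qed.

Definition path_concat {T : Type} (g1 g2 : R -> T) (t : R) : T :=
  if Rle_dec t (/ 2) then g1 (2 * t) else g2 (2 * t - 1).

Lemma is_path_concat {T : Type} (op : (T -> Prop) -> Prop) g1 g2 a b c :
  is_path op g1 a b -> is_path op g2 b c -> is_path op (path_concat g1 g2) a c.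
Proof.
  intros [C1 [A1 B1]] [C2 [A2 B2]]. unfold path_concat. split; [|split].
  - intros t Ht W oW Wt.
    assert (L : forall t, unitI t -> t <= / 2 -> W (g1 (2 * t)) -> exists delta, delta > 0 /\
      forall s, unitI s -> s <= / 2 -> Rabs (s - t) < delta -> W (g1 (2 * s))).
    { intros u Hu Hu' Wu. destruct (C1 (2 * u)) with W as [delta [Hd HW]]; auto.
      { unfold unitI in *. lra. }
      exists (delta / 2). split; [lra|]. intros s Hs Hs' H. apply HW.
      - unfold unitI in *. lra.
      - rewrite <- Rmult_minus_distr_l, Rabs_mult, (Rabs_right 2) by lra. lra. }
    assert (Rt : forall t, unitI t -> / 2 <= t -> W (g2 (2 * t - 1)) -> exists delta, delta > 0 /\
      forall s, unitI s -> / 2 <= s -> Rabs (s - t) < delta -> W (g2 (2 * s - 1))).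
    { intros u Hu Hu' Wu. destruct (C2 (2 * u - 1)) with W as [delta [Hd HW]]; auto.
      { unfold unitI in *. lra. }
      exists (delta / 2). split; [lra|]. intros s Hs Hs' H. apply HW.
      - unfold unitI in *. lra.
      - replace (2 * s - 1 - (2 * u - 1)) with (2 * (s - u)) by ring.
        rewrite Rabs_mult, (Rabs_right 2) by lra. lra. }
    destruct (Rtotal_order t (/ 2)) as [Hlt|[Heq|Hgt]].
    + destruct (Rle_dec t (/ 2)); [|lra].
      destruct (L t) as [delta [Hd HW]]; auto.
      exists (Rmin delta (/ 2 - t)). split; [apply Rmin_pos; lra|].
      intros s Hs H. assert (H1 := Rmin_l delta (/ 2 - t)). assert (H2 := Rmin_r delta (/ 2 - t)).
      assert (H3 := Rle_abs (s - t)).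
      destruct (Rle_dec s (/ 2)); [|lra]. apply HW; auto; lra.
    + destruct (Rle_dec t (/ 2)); [|lra].
      destruct (L t) as [delta [Hd HW]]; auto.
      destruct (Rt t) as [delta' [Hd' HW']]; auto; [lra| |].
      { subst t. replace (2 * / 2 - 1) with 0 by field. rewrite A2, <- B1.
        replace 1 with (2 * / 2) by field. exact Wt. }
      exists (Rmin delta delta'). split; [apply Rmin_pos; lra|].
      intros s Hs H. assert (H1 := Rmin_l delta delta'). assert (H2 := Rmin_r delta delta').
      destruct (Rle_dec s (/ 2)); [apply HW|apply HW']; auto; lra.
    + destruct (Rle_dec t (/ 2)); [lra|].
      destruct (Rt t) as [delta [Hd HW]]; auto; [lra|].
      exists (Rmin delta (t - / 2)). split; [apply Rmin_pos; lra|].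
      intros s Hs H. assert (H1 := Rmin_l delta (t - / 2)). assert (H2 := Rmin_r delta (t - / 2)).
      assert (H3 := Rle_abs (- (s - t))). rewrite Rabs_Ropp in H3.
      destruct (Rle_dec s (/ 2)); [lra|]. apply HW; auto; lra.
  - destruct (Rle_dec 0 (/ 2)); [|lra]. now rewrite Rmult_0_r.
  - destruct (Rle_dec 1 (/ 2)); [lra|]. now replace (2 * 1 - 1) with 1 by ring.
Qed.

Lemma is_path_reverse {T : Type} (op : (T -> Prop) -> Prop) g a b :
  is_path op g a b -> is_path op (fun t => g (1 - t)) b a.
Proof.
  intros [C [A B]]. split; [|split].
  - intros t Ht W oW Wt. destruct (C (1 - t)) with W as [delta [Hd HW]]; auto.
    { unfold unitI in *. lra. }
    exists delta. split; [assumption|]. intros s Hs H. apply HW.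
    + unfold unitI in *. lra.
    + replace (1 - s - (1 - t)) with (- (s - t)) by ring. now rewrite Rabs_Ropp.
  - now rewrite Rminus_0_r.
  - now rewrite Rminus_diag.
Qed.

Lemma is_path_const {T : Type} (op : (T -> Prop) -> Prop) a : is_path op (fun _ => a) a a.
Proof.
  split; [|auto]. intros t Ht W oW Wt. exists 1. split; [lra|auto].
Qed.

(** One half of the agreement of [op] with the topology of [m]: [op] is at least as fine. *)
Definition fine_nbhds {T : Type} (op : (T -> Prop) -> Prop) (m : T -> T -> R) : Prop :=
  forall z delta, delta > 0 -> exists W, op W /\ W z /\ forall w, W w -> m z w < delta.

Lemma fine_nbhds_mopen {T : Type} (m : T -> T -> R) :
  (forall x, m x x = 0) -> (forall x y z, m x z <= m x y + m y z) ->
  fine_nbhds (mopen m) m.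
Proof.
  intros refl tri z delta Hd. exists (fun w => m z w < delta). split; [|split; auto].
  - intros w Hw. exists (delta - m z w). split; [lra|].
    intros y Hy. assert (H := tri z w y). lra.
  - now rewrite refl.
Qed.

(** * Transport along paths and homotopy invariance *)

Section Lifting.
Variables (Y : Type) (op : (Y -> Prop) -> Prop) (m : Y -> Y -> R).
Hypothesis m_refl : forall x, m x x = 0.
Hypothesis m_sym : forall x y, m x y = m y x.
Hypothesis m_tri : forall x y z, m x z <= m x y + m y z.
Hypothesis op_fine : fine_nbhds op m.

Lemma path_uniform g eps : eps > 0 -> path_cont op g ->
  exists delta, delta > 0 /\ forall s s', unitI s -> unitI s' ->
    Rabs (s - s') < delta -> m (g s) (g s') < eps.
Proof.
  intros He C. apply unit_uniform. intros t Ht.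
  destruct (op_fine (g t) (eps / 2)) as [W [oW [Wt HW]]]; [lra|].
  destruct (C t Ht W oW Wt) as [delta [Hd H]].
  exists delta. split; [assumption|]. intros s s' Hs Hs' H1 H2.
  assert (H3 := HW _ (H s Hs H1)). assert (H4 := HW _ (H s' Hs' H2)).
  assert (H5 := m_tri (g s) (g t) (g s')). rewrite (m_sym (g s) (g t)) in H5. lra.
Qed.

(** Inscribe a polygon on a fine grid: its steps are below [r0], so they are no longer than the
    steps of the projected polygon. *)
Lemma chain_along_path {X : Type} (d : X -> X -> R) (p : Y -> X) g r0 L eps t :
  r0 > 0 -> eps > 0 -> path_cont op g -> length_le d (fun s => p (g s)) L ->
  (forall x y, 0 <= d x y) ->
  (forall z w, m z w < r0 -> m z w <= d (p z) (p w)) -> unitI t ->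
  exists l, chain m eps (g 0) (g t) l /\ l <= L.
Proof.
  intros Hr He C HL d_pos Hp Ht.
  destruct (path_uniform g (Rmin eps r0)) as [delta [Hd H]]; [now apply Rmin_pos|assumption|].
  destruct (mesh delta Hd) as [N [HN Hmesh]]. specialize (Hmesh N (le_n N)).
  set (f := fun i => grid N i * t).
  assert (Hf : forall i, (i <= N)%nat -> unitI (f i)).
  { intros i Hi. destruct (grid_unit N i HN Hi). unfold f, unitI in *. nra. }
  assert (Hstep : forall i, (S i <= N)%nat -> m (g (f i)) (g (f (S i))) < Rmin eps r0).
  { intros i Hi. apply H; [apply Hf; lia|now apply Hf|].
    unfold f. rewrite <- Rmult_minus_distr_r, Rabs_mult.
    assert (Hm := Hmesh i).
    assert (Ht' : Rabs t <= 1) by (rewrite Rabs_right; unfold unitI in Ht; lra).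
    assert (H1 := Rabs_pos t). assert (H2 := Rabs_pos (grid N i - grid N (S i))). nra. }
  (* [length_le] speaks of partitions of all of [[0, 1]], so the partition of [[0, t]] is completed
     by the point 1, at a nonnegative cost. *)
  set (f' := fun i => if Nat.leb i N then f i else 1).
  assert (Hl : forall i, (i <= N)%nat -> exists l, chain m eps (g 0) (g (f i)) l /\
    l <= psum d (fun s => p (g s)) f' i).
  { induction i as [|i IH]; intros Hi.
    - exists 0. unfold f. rewrite grid_0, Rmult_0_l. split; [constructor|simpl; lra].
    - destruct IH as [l [Cl IH]]; [lia|].
      specialize (Hstep i Hi).
      assert (H1 := Rmin_l eps r0). assert (H2 := Rmin_r eps r0).
      exists (l + m (g (f i)) (g (f (S i)))). split.
      + constructor; [assumption|lra].
      + simpl. unfold f' at 2 3.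
        rewrite !(proj2 (Nat.leb_le _ _)) by lia.
        assert (H3 := Hp (g (f i)) (g (f (S i)))). lra. }
  destruct (Hl N (le_n N)) as [l [Cl Hl']].
  assert (HfN : f N = t) by (unfold f; rewrite grid_N by assumption; ring).
  rewrite HfN in Cl.
  exists l. split; [assumption|].
  assert (HS : psum d (fun s => p (g s)) f' (S N) <= L).
  { apply HL.
    - unfold f', f. simpl. rewrite grid_0. ring.
    - unfold f'. now rewrite (proj2 (Nat.leb_gt _ _)) by lia.
    - intros i Hi. unfold f'. rewrite (proj2 (Nat.leb_le i N)) by lia.
      destruct (Nat.leb_spec (S i) N) as [Hi'|Hi'].
      + unfold f. assert (H1 := grid_le N i HN). unfold unitI in Ht. nra.
      + destruct (Hf i ltac:(lia)). assumption. }
  simpl in HS. assert (H1 := d_pos (p (g (f' N))) (p (g (f' (S N))))). lra.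
Qed.

Section Transport.
Variables (S : Type) (pr : S -> Y) (tr : S -> Y -> S) (eps : R).
Hypothesis eps_pos : eps > 0.
Hypothesis coh : coherent m pr tr eps.

Fixpoint follow (f : nat -> Y) (s : S) (k : nat) : S :=
  match k with
  | O => s
  | Datatypes.S k' => tr (follow f s k') (f k)
  end.

Lemma follow_pr f s k : pr s = f O -> pr (follow f s k) = f k.
Proof. destruct k; [trivial|]. intros _. apply coh. Qed.

Lemma follow_const s k : follow (fun _ => pr s) s k = s.
Proof.
  induction k as [|k IH]; [reflexivity|]. simpl. rewrite IH. apply coh.
Qed.

(** Along the ladder between [f] and [f'], coherence keeps the lift along [f'] equal to the lift
    along [f] moved across the rung. *)
Lemma follow_adjacent (f f' : nat -> Y) N s :
  pr s = f O -> f O = f' O -> f N = f' N ->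
  (forall i, (i < N)%nat -> m (f i) (f (Datatypes.S i)) < eps /\
     m (f i) (f' i) < eps /\ m (f' i) (f' (Datatypes.S i)) < eps /\
     m (f i) (f' (Datatypes.S i)) < eps /\
     m (f (Datatypes.S i)) (f' (Datatypes.S i)) < eps) ->
  follow f s N = follow f' s N.
Proof.
  intros Hs H0 HN H. destruct coh as [c1 [c2 c3]].
  assert (K : forall i, (i <= N)%nat -> follow f' s i = tr (follow f s i) (f' i)).
  { induction i as [|i IH]; intros Hi.
    - simpl. rewrite <- H0, <- Hs. symmetry. apply c2.
    - destruct (H i Hi) as [H1 [H2 [H3 [H4 H5]]]].
      assert (P := follow_pr f s i Hs).
      simpl. rewrite IH by lia. rewrite !c3; rewrite ?P; auto. }
  rewrite (K N (le_n N)), <- HN, <- (follow_pr f s N Hs). symmetry. apply c2.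
Qed.

(** Neighbouring rows of a fine grid on the homotopy square are adjacent in the sense of
    [follow_adjacent]. A threshold [N0] instead of a single [N] allows several paths to share one
    grid. *)
Lemma homotopic_follow g1 g2 : homotopic op g1 g2 ->
  exists N0, (0 < N0)%nat /\ forall N, (N0 <= N)%nat -> forall s, pr s = g1 0 ->
    follow (fun i => g1 (grid N i)) s N = follow (fun i => g2 (grid N i)) s N.
Proof.
  intros [H [HC [H01 Hend]]].
  destruct (unit_uniform2 (fun s t s' t' => m (H s t) (H s' t') < eps)) as [delta [Hd HU]].
  { intros u v Hu Hv.
    destruct (op_fine (H u v) (eps / 2)) as [W [oW [Wt HW]]]; [lra|].
    destruct (HC u v Hu Hv W oW Wt) as [delta [Hd HD]].
    exists delta. split; [assumption|]. intros s t s' t' Hs Ht Hs' Ht' H1 H2 H3 H4.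
    assert (H5 := HW _ (HD s t Hs Ht H1 H2)). assert (H6 := HW _ (HD s' t' Hs' Ht' H3 H4)).
    assert (H7 := m_tri (H s t) (H u v) (H s' t')). rewrite (m_sym (H s t) (H u v)) in H7. lra. }
  destruct (mesh delta Hd) as [N0 [HN0 Hmesh]].
  exists N0. split; [assumption|]. intros N HN s Hs.
  specialize (Hmesh N HN).
  assert (N_pos : (0 < N)%nat) by lia.
  assert (G := grid_unit N). assert (U0 : unitI 0) by (unfold unitI; lra).
  assert (U1 : unitI 1) by (unfold unitI; lra).
  set (row := fun j i => H (grid N j) (grid N i)).
  assert (Hrow : forall j, (j <= N)%nat -> row j 0%nat = g1 0 /\ row j N = g1 1).
  { intros j Hj. unfold row. rewrite grid_0, grid_N by assumption. apply Hend. auto. }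
  assert (K : forall j, (j <= N)%nat -> follow (row O) s N = follow (row j) s N).
  { induction j as [|j IH]; intros Hj; [reflexivity|].
    rewrite IH by lia.
    destruct (Hrow j) as [A1 A2]; [lia|]. destruct (Hrow (Datatypes.S j) Hj) as [B1 B2].
    apply follow_adjacent; [congruence..|].
    intros i Hi. unfold row.
    repeat split; apply HU; try (apply G; lia); rewrite ?Rminus_diag, ?Rabs_R0; auto. }
  assert (ext : forall f f', (forall i, (i <= N)%nat -> f i = f' i) ->
    follow f s N = follow f' s N).
  { intros f f' E. assert (E' : forall i, (i <= N)%nat -> follow f s i = follow f' s i).
    { induction i as [|i IH]; intros Hi; [reflexivity|]. simpl. rewrite IH, E by lia. reflexivity. }
    now apply E'. }
  transitivity (follow (row O) s N).
  - apply ext. intros i Hi. unfold row. rewrite grid_0. symmetry. apply H01. auto.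
  - rewrite (K N (le_n N)). apply ext. intros i Hi. unfold row. rewrite grid_N by assumption.
    apply H01. auto.
Qed.

(** A topology on the total space, in which discrete transport can be compared with genuine
    paths. *)
Definition total_open (W : S -> Prop) : Prop :=
  forall s, W s -> exists delta, delta > 0 /\ forall y, m (pr s) y < delta -> W (tr s y).

Lemma sheet_open s : total_open (fun s' => m (pr s) (pr s') < eps /\ s' = tr s (pr s')).
Proof.
  destruct coh as [c1 [c2 c3]].
  intros s' [H E]. exists (Rmin eps (eps - m (pr s) (pr s'))).
  split; [apply Rmin_pos; lra|]. intros y Hy.
  assert (H1 := Rmin_l eps (eps - m (pr s) (pr s'))).
  assert (H2 := Rmin_r eps (eps - m (pr s) (pr s'))).
  assert (H3 := m_tri (pr s) (pr s') y). rewrite c1. split; [lra|].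
  rewrite E at 1. apply c3; lra.
Qed.

(** By compactness, values of [sigma] at close parameters lie in one sheet, where each is the
    transport of the other. *)
Lemma path_follow sigma : path_cont total_open sigma ->
  exists N0, (0 < N0)%nat /\ forall N, (N0 <= N)%nat ->
    follow (fun i => pr (sigma (grid N i))) (sigma 0) N = sigma 1.
Proof.
  intros C. destruct coh as [c1 [c2 c3]].
  destruct (unit_uniform (fun t t' => sigma t' = tr (sigma t) (pr (sigma t'))))
    as [delta [Hd H]].
  { intros u Hu.
    (* The radius [eps / 2] puts any two points of [W] within [eps] of each other, as coherence
       requires. *)
    set (W := fun s' => m (pr (sigma u)) (pr s') < eps / 2 /\
                        (m (pr (sigma u)) (pr s') < eps /\ s' = tr (sigma u) (pr s'))).
    destruct (C u Hu W) as [delta [Hd H]].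
    - intros s' [H1 H2].
      destruct (sheet_open _ _ H2) as [delta [Hd H]].
      exists (Rmin delta (eps / 2 - m (pr (sigma u)) (pr s'))).
      split; [apply Rmin_pos; lra|]. intros y Hy.
      assert (H3 := Rmin_l delta (eps / 2 - m (pr (sigma u)) (pr s'))).
      assert (H4 := Rmin_r delta (eps / 2 - m (pr (sigma u)) (pr s'))).
      split; [|apply H; lra]. rewrite c1.
      assert (H5 := m_tri (pr (sigma u)) (pr s') y). lra.
    - unfold W. rewrite m_refl, c2. repeat split; lra.
    - exists delta. split; [assumption|]. intros s s' Hs Hs' H1 H2.
      destruct (H s Hs H1) as [A1 [A2 A3]]. destruct (H s' Hs' H2) as [B1 [B2 B3]].
      rewrite B3 at 1. rewrite A3 at 1. symmetry. apply c3; auto.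
      assert (H5 := m_tri (pr (sigma s)) (pr (sigma u)) (pr (sigma s'))).
      rewrite (m_sym (pr (sigma s)) (pr (sigma u))) in H5. lra. }
  destruct (mesh delta Hd) as [N0 [HN0 Hmesh]].
  exists N0. split; [assumption|]. intros N HN. specialize (Hmesh N HN).
  assert (N_pos : (0 < N)%nat) by lia. assert (G := grid_unit N).
  assert (K : forall i, (i <= N)%nat ->
    follow (fun i => pr (sigma (grid N i))) (sigma 0) i = sigma (grid N i)).
  { induction i as [|i IH]; intros Hi.
    - now rewrite grid_0.
    - simpl. rewrite IH by lia. symmetry. apply H; auto. apply G; lia. }
  rewrite (K N (le_n N)), grid_N by assumption. reflexivity.
Qed.

End Transport.

(** Short paths turn a [reach] sequence into a path of the total space over a loop. Transport along
    the loop ends at [s'] by [path_follow], and at [s] because the loop contracts. *)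
Lemma simply_connected_trivial_monodromy :
  (forall W, op W -> mopen m W) ->
  (forall z w eps, m z w < eps -> exists g, is_path op g z w /\
     forall t, unitI t -> m z (g t) < eps) ->
  simply_connected op -> trivial_monodromy m.
Proof.
  intros Hop Hshort [_ Hsc] S pr tr eps He coh s s' Hr E.
  assert (coh' := coh). destruct coh' as [c1 [c2 c3]].
  assert (Hpath : exists sigma, is_path (total_open S pr tr) sigma s s').
  { clear E. induction Hr as [|s' y Hr [sigma1 IH] Hy].
    - exists (fun _ => s). apply is_path_const.
    - destruct (Hshort _ _ _ Hy) as [g [[gC [g0 g1]] gE]].
      exists (path_concat sigma1 (fun t => tr s' (g t))).
      apply is_path_concat with s'; [assumption|]. split; [|split].
      + intros t Ht W oW Wt. destruct (oW _ Wt) as [delta [Hd HW]]. rewrite c1 in HW.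
        destruct (op_fine (g t) (Rmin delta eps)) as [V [oV [Vt HV]]]; [now apply Rmin_pos|].
        destruct (gC t Ht V oV Vt) as [delta' [Hd' H]].
        exists delta'. split; [assumption|]. intros u Hu Hut.
        assert (H1 := HV _ (H u Hu Hut)).
        assert (H2 := Rmin_l delta eps). assert (H3 := Rmin_r delta eps).
        rewrite <- (c3 s' (g t)); auto; try lra. apply HW. lra.
      + rewrite g0. apply c2.
      + now rewrite g1. }
  destruct Hpath as [sigma [sC [s0 s1]]].
  destruct (path_follow S pr tr eps He coh sigma sC) as [N1 [HN1 H1]].
  assert (Hloop : is_path op (fun t => pr (sigma t)) (pr s) (pr s)).
  { split; [|split; congruence].
    intros t Ht W oW Wt. apply (sC t Ht (fun u => W (pr u))); [|assumption].
    intros u Wu. destruct (Hop W oW _ Wu) as [delta [Hd HW]].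
    exists delta. split; [assumption|]. intros y Hy. rewrite c1. auto. }
  destruct (homotopic_follow S pr tr eps He coh _ _ (Hsc _ _ Hloop)) as [N2 [HN2 H2]].
  specialize (H1 (N1 + N2)%nat ltac:(lia)).
  specialize (H2 (N1 + N2)%nat ltac:(lia) s ltac:(congruence)).
  cbv beta in H2. rewrite (follow_const S pr tr eps coh) in H2.
  congruence.
Qed.

End Lifting.

(** * Lengths and the lifted metric *)

Lemma partition_unit (t : nat -> R) k : t O = 0 -> t k = 1 ->
  (forall i, (i < k)%nat -> t i <= t (S i)) -> forall i, (i <= k)%nat -> unitI (t i).
Proof.
  intros H0 Hk Hm.
  assert (Hij : forall j i, (i + j <= k)%nat -> t i <= t (i + j)%nat).
  { induction j as [|j IH]; intros i Hi.
    - rewrite Nat.add_0_r. lra.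
    - rewrite Nat.add_succ_r. apply Rle_trans with (t (i + j)%nat); [apply IH|apply Hm]; lia. }
  intros i Hi. split.
  - rewrite <- H0. apply (Hij i 0%nat). lia.
  - rewrite <- Hk. replace k with (i + (k - i))%nat by lia. apply Hij. lia.
Qed.

Section Length.
Variables (X : Type) (d : X -> X -> R).
Hypothesis d_metric : is_metric d.

Let d_pos : forall x y, 0 <= d x y := proj1 d_metric.
Let d_sym : forall x y, d x y = d y x := proj1 (proj2 (proj2 d_metric)).
Let d_tri : forall x y z, d x z <= d x y + d y z := proj2 (proj2 (proj2 d_metric)).

Lemma metric_refl x : d x x = 0.
Proof. now apply (proj1 (proj2 d_metric)). Qed.

Lemma length_le_ext g g' L : (forall t, unitI t -> g t = g' t) ->
  length_le d g L -> length_le d g' L.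
Proof.
  intros E H k t H0 Hk Hm.
  assert (U := partition_unit t k H0 Hk Hm).
  rewrite <- (H k t H0 Hk Hm). apply Req_le. clear Hk Hm H0 H.
  induction k as [|k IH]; [reflexivity|]. simpl.
  rewrite IH by (intros; apply U; lia). now rewrite !E by (apply U; lia).
Qed.

Lemma length_le_mono g L L' : L <= L' -> length_le d g L -> length_le d g L'.
Proof. intros HL H k t H0 Hk Hm. specialize (H k t H0 Hk Hm). lra. Qed.

Lemma length_le_const x : length_le d (fun _ => x) 0.
Proof.
  intros k t _ _ _. induction k as [|k IH]; simpl; [lra|]. rewrite metric_refl. lra.
Qed.

Lemma psum_head g t k :
  psum d g t (S k) = d (g (t O)) (g (t 1%nat)) + psum d g (fun i => t (S i)) k.
Proof.
  induction k as [|k IH]; [simpl; ring|].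
  change (psum d g t (S (S k))) with (psum d g t (S k) + d (g (t (S k))) (g (t (S (S k))))).
  rewrite IH. simpl. ring.
Qed.

Lemma psum_reverse g t k :
  psum d (fun s => g (1 - s)) t k = psum d g (fun i => 1 - t (k - i)%nat) k.
Proof.
  induction k as [|k IH]; [reflexivity|].
  rewrite (psum_head g). simpl. rewrite IH, Nat.sub_0_r, d_sym. ring.
Qed.

Lemma length_le_reverse g L : length_le d g L -> length_le d (fun t => g (1 - t)) L.
Proof.
  intros H k t H0 Hk Hm. rewrite psum_reverse. apply H.
  - rewrite Nat.sub_0_r, Hk. ring.
  - rewrite Nat.sub_diag, H0. ring.
  - intros i Hi. replace (k - i)%nat with (S (k - S i)) by lia.
    assert (H1 := Hm (k - S i)%nat ltac:(lia)). lra.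
Qed.

(* A partition t of [0,1] induces the partitions min(2t,1) and max(2t-1,0) for the
   two halves. *)
Lemma length_le_concat g1 g2 L1 L2 : g1 1 = g2 0 ->
  length_le d g1 L1 -> length_le d g2 L2 -> length_le d (path_concat g1 g2) (L1 + L2).
Proof.
  intros E H1 H2 k t H0 Hk Hm.
  set (t1 := fun i => Rmin (2 * t i) 1). set (t2 := fun i => Rmax (2 * t i - 1) 0).
  apply Rle_trans with (psum d g1 t1 k + psum d g2 t2 k).
  - clear H0 Hk. induction k as [|k IH]; [simpl; lra|].
    simpl. specialize (IH (fun i Hi => Hm i (Nat.lt_lt_succ_r _ _ Hi))).
    assert (Hk := Hm k (Nat.lt_succ_diag_r k)).
    assert (K : d (path_concat g1 g2 (t k)) (path_concat g1 g2 (t (S k))) <=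
      d (g1 (t1 k)) (g1 (t1 (S k))) + d (g2 (t2 k)) (g2 (t2 (S k)))); [|lra].
    unfold path_concat, t1, t2.
    destruct (Rle_dec (t k) (/ 2)); destruct (Rle_dec (t (S k)) (/ 2)); try lra.
    + rewrite !Rmin_left, !Rmax_right by lra. rewrite (metric_refl (g2 0)). lra.
    + rewrite Rmin_left, Rmin_right, Rmax_right, Rmax_left by lra. rewrite E. apply d_tri.
    + rewrite !Rmin_right, !Rmax_left by lra. rewrite metric_refl. lra.
  - assert (A1 : psum d g1 t1 k <= L1).
    { apply H1; unfold t1.
      - rewrite H0. apply Rmin_case_strong; lra.
      - rewrite Hk. apply Rmin_case_strong; lra.
      - intros i Hi. specialize (Hm i Hi). apply Rle_min_compat_r. lra. }
    assert (A2 : psum d g2 t2 k <= L2).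
    { apply H2; unfold t2.
      - rewrite H0. apply Rmax_case_strong; lra.
      - rewrite Hk. apply Rmax_case_strong; lra.
      - intros i Hi. specialize (Hm i Hi). apply Rle_max_compat_r. lra. }
    lra.
Qed.

Lemma length_le_dist g L t : length_le d g L -> unitI t -> d (g 0) (g t) <= L.
Proof.
  intros H [Ht0 Ht1].
  assert (H1 := H 2%nat (fun i => match i with O => 0 | 1%nat => t | _ => 1 end)
    eq_refl eq_refl). simpl in H1.
  assert (H2 := d_pos (g t) (g 1)).
  enough (0 + d (g 0) (g t) + d (g t) (g 1) <= L) by lra.
  apply H1. intros [|[|i]] Hi; try lra; lia.
Qed.

End Length.

(** * Local sections and the metric of the cover *)

Section Cover.
Variables (X : Type) (d : X -> X -> R) (M : Type) (op : (M -> Prop) -> Prop) (rho : M -> X).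
Hypothesis d_length : length_space d.
Hypothesis d_compact : compact_metric d.
Hypothesis op_top : is_topology op.
Hypothesis rho_cover : covering_map op (mopen d) rho.

Let d_metric := proj1 d_length.
Let d_pos : forall x y, 0 <= d x y := proj1 d_metric.
Let d_refl : forall x, d x x = 0 := metric_refl X d d_metric.
Let d_sym : forall x y, d x y = d y x := proj1 (proj2 (proj2 d_metric)).
Let d_tri : forall x y z, d x z <= d x y + d y z := proj2 (proj2 (proj2 d_metric)).

Lemma ball_open x r : mopen d (fun y => d x y < r).
Proof.
  intros y Hy. exists (r - d x y). split; [lra|]. intros z Hz.
  assert (H := d_tri x y z). lra.
Qed.

Lemma lebesgue_number : exists r0, r0 > 0 /\ forall x, exists U,
  mopen d U /\ evenly_covered op (mopen d) rho U /\ forall y, d x y < r0 -> U y.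
Proof.
  set (good := fun x r => exists U,
    mopen d U /\ evenly_covered op (mopen d) rho U /\ forall y, d x y < r -> U y).
  (* The stored radius is half of a good one, so a ball of this size about any point of the stored
     ball is still evenly covered. The minimum over a finite subcover is the Lebesgue number. *)
  set (I := {xr : X * R | snd xr > 0 /\ good (fst xr) (2 * snd xr)}).
  destruct (d_compact I (fun i y => d (fst (proj1_sig i)) y < snd (proj1_sig i))) as [l Hl].
  { intros i. apply ball_open. }
  { intros x. destruct rho_cover as [_ [_ H]]. destruct (H x) as [U [oU [Ux eU]]].
    destruct (oU x Ux) as [r [Hr HU]].
    assert (Hg : r / 2 > 0 /\ good x (2 * (r / 2))).
    { split; [lra|]. exists U. repeat split; auto. intros y Hy. apply HU. lra. }
    exists (exist _ (x, r / 2) Hg). simpl. rewrite d_refl. lra. }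
  assert (Hr : exists r0, r0 > 0 /\ forall i, In i l -> r0 <= snd (proj1_sig i)).
  { clear Hl. induction l as [|i l [r0 [Hr IH]]].
    - exists 1. split; [lra|intros i []].
    - exists (Rmin r0 (snd (proj1_sig i))). split.
      + apply Rmin_pos; [assumption|]. apply (proj2_sig i).
      + intros j [<-|Hj]; [apply Rmin_r|].
        apply Rle_trans with r0; [apply Rmin_l|auto]. }
  destruct Hr as [r0 [Hr Hmin]]. exists r0. split; [assumption|].
  intros x. destruct (Hl x) as [i [Ii Hi]]. specialize (Hmin i Ii).
  destruct i as [[xi ri] [Hri [U [oU [eU HU]]]]]; simpl in *.
  exists U. repeat split; auto. intros y Hy. apply HU.
  assert (H := d_tri xi x y). lra.
Qed.

(** The last two clauses stand for the sheet of [z]: points near [z], and points joined to [z] by a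
    path over the ball, are values of the section. *)
Definition local_section (r0 : R) (z : M) (s : X -> M) : Prop :=
  s (rho z) = z /\
  (forall y, d (rho z) y < r0 -> rho (s y) = y) /\
  continuous_on (mopen d) op (fun y => d (rho z) y < r0) s /\
  (exists W, op W /\ W z /\ forall w, W w -> d (rho z) (rho w) < r0 /\ s (rho w) = w) /\
  (forall g, path_cont op g -> g 0 = z ->
     (forall t, unitI t -> d (rho z) (rho (g t)) < r0) ->
     forall t, unitI t -> s (rho (g t)) = g t).

Lemma local_section_exists : exists r0, r0 > 0 /\
  forall z, exists s, local_section r0 z s.
Proof.
  destruct lebesgue_number as [r0 [Hr H]]. exists r0. split; [assumption|].
  intros z. destruct (H (rho z)) as [U [oU [[J [V [oV [cV [dV sV]]]]] HU]]].
  assert (Uz : U (rho z)) by (apply HU; rewrite d_refl; lra).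
  destruct (proj1 (cV z) Uz) as [j Vz].
  destruct (sV j) as [s [s1 [s2 s3]]].
  exists s. split; [|split; [|split; [|split]]].
  - now apply s2.
  - intros y Hy. now apply s1, HU.
  - intros x Hx W oW Wx. destruct (s3 x (HU x Hx) W oW Wx) as [O [oO [Ox HO]]].
    exists O. repeat split; auto.
  - exists (fun w => V j w /\ d (rho z) (rho w) < r0). split; [|split].
    + apply op_top; [apply oV|]. apply (proj1 rho_cover (fun y => d (rho z) y < r0)).
      apply ball_open.
    + split; [assumption|rewrite d_refl; lra].
    + intros w [Vw Hw]. split; [assumption|now apply s2].
  - intros g gC g0 gU.
    (* The sheets are open and disjoint, so a path over [U] cannot leave the sheet in which it
       starts. *)
    assert (HV : forall t, unitI t -> unitI t /\ V j (g t)).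
    { intros t Ht. split; [assumption|]. revert t Ht.
      apply (unit_propagate (fun t => V j (g t))); [now rewrite g0|].
      intros t Ht. destruct (proj1 (cV (g t)) (HU _ (gU t Ht))) as [k Vk].
      destruct (gC t Ht (V k) (oV k) Vk) as [delta [Hd HD]].
      exists delta. split; [assumption|]. intros s' s'' Hs Hs' H1 H2 Hj.
      rewrite (dV j k (g s') Hj (HD s' Hs H1)). now apply HD. }
    intros t Ht. apply s2. now apply HV.
Qed.

(** Upper bounds replace lengths, since a projected path may have infinite length. *)
Definition rect (a b : M) (L : R) : Prop :=
  exists g, is_path op g a b /\ length_le d (fun t => rho (g t)) L.

Lemma rect_refl a : rect a a 0.
Proof. exists (fun _ => a). split; [apply is_path_const|]. now apply length_le_const. Qed.

Lemma rect_sym a b L : rect a b L -> rect b a L.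
Proof.
  intros [g [Hg HL]]. exists (fun t => g (1 - t)). split; [now apply is_path_reverse|].
  apply (length_le_reverse X d d_metric (fun t => rho (g t))). assumption.
Qed.

Lemma rect_trans a b c L L' : rect a b L -> rect b c L' -> rect a c (L + L').
Proof.
  intros [g [Hg HL]] [g' [Hg' HL']]. exists (path_concat g g').
  split; [now apply is_path_concat with b|].
  apply length_le_ext with (path_concat (fun t => rho (g t)) (fun t => rho (g' t))).
  - intros t Ht. unfold path_concat. now destruct Rle_dec.
  - apply length_le_concat; auto.
    destruct Hg as [_ [_ ->]]. now destruct Hg' as [_ [-> _]].
Qed.

Lemma rect_dist a b L : rect a b L -> d (rho a) (rho b) <= L.
Proof.
  intros [g [[gC [g0 g1]] HL]].
  assert (H := length_le_dist X d d_metric _ L 1 HL ltac:(unfold unitI; lra)).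
  cbv beta in H. now rewrite g0, g1 in H.
Qed.

(** An almost shortest path of [X] from [rho z] to [y] stays in the ball, so the section lifts
    it. *)
Lemma rect_section r0 z s y L : local_section r0 z s -> d (rho z) y < L -> L < r0 ->
  rect z (s y) L.
Proof.
  intros [s1 [s2 [s3 _]]] HL Hr.
  destruct (proj2 d_length (rho z) y (L - d (rho z) y)) as [h [[hC [h0 h1]] Hh]]; [lra|].
  replace (d (rho z) y + (L - d (rho z) y)) with L in Hh by ring.
  assert (Hball : forall t, unitI t -> d (rho z) (h t) < r0).
  { intros t Ht. rewrite <- h0. assert (H := length_le_dist X d d_metric _ L t Hh Ht). lra. }
  exists (fun t => s (h t)). split; [split; [|split]|].
  - intros t Ht W oW Wt. destruct (s3 (h t) (Hball t Ht) W oW Wt) as [O [oO [Ot HO]]].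
    destruct (hC t Ht O oO Ot) as [delta [Hd H]].
    exists delta. split; [assumption|]. intros u Hu Hut. apply HO; auto.
  - now rewrite h0.
  - now rewrite h1.
  - apply length_le_ext with h; [|assumption]. intros t Ht. symmetry. auto.
Qed.

Lemma section_unique r0 z s w L : local_section r0 z s -> rect z w L -> L < r0 ->
  s (rho w) = w.
Proof.
  intros [s1 [s2 [s3 [_ s5]]]] [g [[gC [g0 g1]] HL]] Hr.
  rewrite <- g1. apply s5; auto; [|unfold unitI; lra].
  intros t Ht. rewrite <- g0.
  assert (H := length_le_dist X d d_metric _ L t HL Ht). simpl in H. lra.
Qed.

(** A given path need not be rectifiable. Being joined to [a] by some rectifiable path propagates
    along it, because nearby points are joined through [rect_section]. *)
Lemma rect_exists a b : (forall a b : M, exists g, is_path op g a b) -> exists L, rect a b L.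
Proof.
  intros Hconn. destruct (Hconn a b) as [g [gC [g0 g1]]].
  destruct local_section_exists as [r0 [Hr Hsec]].
  enough (H : forall t, unitI t -> exists L, rect a (g t) L).
  { rewrite <- g1. apply H. unfold unitI; lra. }
  apply (unit_propagate (fun t => exists L, rect a (g t) L)).
  { exists 0. rewrite g0. apply rect_refl. }
  intros t Ht. destruct (Hsec (g t)) as [s Hs].
  assert (Hs' := Hs). destruct Hs' as [_ [_ [_ [[W [oW [Wt HW]]] _]]]].
  destruct (gC t Ht W oW Wt) as [delta [Hd H]].
  exists delta. split; [assumption|].
  assert (K : forall u, unitI u -> Rabs (u - t) < delta -> exists L, rect (g t) (g u) L).
  { intros u Hu Hut. destruct (HW _ (H u Hu Hut)) as [H1 H2].
    exists ((d (rho (g t)) (rho (g u)) + r0) / 2). rewrite <- H2 at 1.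
    apply rect_section with r0; [assumption|lra|lra]. }
  intros u u' Hu Hu' H1 H2 [L HL].
  destruct (K u Hu H1) as [L1 HL1]. destruct (K u' Hu' H2) as [L2 HL2].
  exists (L + L1 + L2). apply rect_trans with (g t); [|assumption].
  apply rect_trans with (g u); [assumption|now apply rect_sym].
Qed.

Lemma glb_exists (P : R -> Prop) : (exists x, P x) -> (forall x, P x -> 0 <= x) ->
  exists m, (forall x, P x -> m <= x) /\ (forall eta, eta > 0 -> exists x, P x /\ x < m + eta).
Proof.
  intros [x0 Hx0] Hpos.
  destruct (completeness (fun y => P (- y))) as [m [Hm1 Hm2]].
  - exists 0. intros y Hy. apply Hpos in Hy. lra.
  - exists (- x0). now rewrite Ropp_involutive.
  - exists (- m). split.
    + intros x Hx. assert (H := Hm1 (- x)). cbv beta in H.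
      rewrite Ropp_involutive in H. specialize (H Hx). lra.
    + intros eta Heta. apply NNPP. intros N.
      assert (H : m <= m - eta); [|lra].
      apply Hm2. intros y Hy. apply Rnot_lt_le. intros L.
      apply N. exists (- y). split; [assumption|lra].
Qed.

Definition is_lifted_metric (e : M -> M -> R) : Prop :=
  forall a b, (forall L, rect a b L -> e a b <= L) /\
    (forall eta, eta > 0 -> exists L, rect a b L /\ L < e a b + eta).

Lemma lifted_metric_exists : (forall a b : M, exists g, is_path op g a b) ->
  exists e, is_lifted_metric e.
Proof.
  intros Hconn.
  assert (H : forall a b, exists m, (forall L, rect a b L -> m <= L) /\
    (forall eta, eta > 0 -> exists L, rect a b L /\ L < m + eta)).
  { intros a b. apply glb_exists; [now apply rect_exists|].
    intros L HL. apply rect_dist in HL. assert (H := d_pos (rho a) (rho b)). lra. }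
  exists (fun a b => proj1_sig (constructive_indefinite_description _ (H a b))).
  intros a b. apply proj2_sig.
Qed.

Section LiftedMetric.
Variables (e : M -> M -> R) (r0 : R) (sec : M -> X -> M).
Hypothesis e_lifted : is_lifted_metric e.
Hypothesis r0_pos : r0 > 0.
Hypothesis sec_local : forall z, local_section r0 z (sec z).

Lemma lifted_dist_le_iff a b L : lifted_dist_le op d rho a b L <-> e a b <= L.
Proof.
  destruct (e_lifted a b) as [H1 H2]. split.
  - intros H. apply Rnot_lt_le. intros Hlt.
    destruct (H ((e a b - L) / 2)) as [g Hg]; [lra|].
    assert (H3 := H1 _ (ex_intro _ g Hg)). lra.
  - intros H eps He. destruct (H2 eps He) as [L' [[g [Hg HL]] HL']].
    exists g. split; [assumption|]. apply length_le_mono with L'; [lra|assumption].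
Qed.

Lemma lifted_lip a b : d (rho a) (rho b) <= e a b.
Proof.
  apply Rnot_lt_le. intros H.
  destruct (proj2 (e_lifted a b) (d (rho a) (rho b) - e a b)) as [L [HL H']]; [lra|].
  apply rect_dist in HL. lra.
Qed.

Lemma lifted_pos a b : 0 <= e a b.
Proof. apply Rle_trans with (d (rho a) (rho b)); [apply d_pos|apply lifted_lip]. Qed.

Lemma lifted_refl a : e a a = 0.
Proof.
  apply Rle_antisym; [|apply lifted_pos]. apply e_lifted, rect_refl.
Qed.

Lemma lifted_sym a b : e a b = e b a.
Proof.
  assert (H : forall a b, e a b <= e b a); [|apply Rle_antisym; auto].
  clear a b. intros a b. apply Rnot_lt_le. intros H.
  destruct (proj2 (e_lifted b a) (e a b - e b a)) as [L [HL H']]; [lra|].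
  apply rect_sym in HL. apply e_lifted in HL. lra.
Qed.

Lemma lifted_tri a b c : e a c <= e a b + e b c.
Proof.
  apply Rnot_lt_le. intros H.
  set (eta := (e a c - (e a b + e b c)) / 2).
  destruct (proj2 (e_lifted a b) eta) as [L [HL H']]; [unfold eta; lra|].
  destruct (proj2 (e_lifted b c) eta) as [L1 [HL1 H1']]; [unfold eta; lra|].
  assert (HL2 := proj1 (e_lifted a c) _ (rect_trans _ _ _ _ _ HL HL1)).
  unfold eta in *. lra.
Qed.

Lemma sec_near z y : d (rho z) y < r0 -> e z (sec z y) <= d (rho z) y.
Proof.
  intros Hy. apply Rnot_lt_le. intros H.
  set (L := (d (rho z) y + Rmin r0 (e z (sec z y))) / 2).
  assert (H1 := Rmin_l r0 (e z (sec z y))). assert (H2 := Rmin_r r0 (e z (sec z y))).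
  assert (H3 : d (rho z) y < Rmin r0 (e z (sec z y))) by now apply Rmin_glb_lt.
  assert (HL : rect z (sec z y) L).
  { apply rect_section with r0; [apply sec_local| |]; unfold L; lra. }
  apply e_lifted in HL. unfold L in HL. lra.
Qed.

Lemma sec_unique z w : e z w < r0 -> sec z (rho w) = w.
Proof.
  intros H. destruct (proj2 (e_lifted z w) (r0 - e z w)) as [L [HL H']]; [lra|].
  apply section_unique with r0 z L; [apply sec_local|assumption|lra].
Qed.

(** With [lifted_lip], [rho] preserves distances to the centre of an [r0]-ball. *)
Lemma lifted_local z w : e z w < r0 -> e z w <= d (rho z) (rho w).
Proof.
  intros H. rewrite <- (sec_unique z w H) at 1. apply sec_near.
  assert (H1 := lifted_lip z w). lra.
Qed.

Lemma lifted_fine : fine_nbhds op e.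
Proof.
  intros z delta Hd.
  destruct (sec_local z) as [s1 [s2 [s3 [[W [oW [Wz HW]]] s5]]]].
  exists (fun w => W w /\ d (rho z) (rho w) < delta). split; [|split].
  - apply op_top; [assumption|].
    apply (proj1 rho_cover (fun y => d (rho z) y < delta)). apply ball_open.
  - split; [assumption|]. now rewrite d_refl.
  - intros w [Ww Hw]. destruct (HW w Ww) as [H1 H2].
    apply sec_near in H1. rewrite H2 in H1. lra.
Qed.

(** With [lifted_fine], this identifies the topology of the cover with that of [e]. *)
Lemma lifted_coarse W : op W -> mopen e W.
Proof.
  intros oW z Wz.
  destruct (sec_local z) as [s1 [s2 [s3 _]]].
  destruct (s3 (rho z)) with W as [O [oO [Oz HO]]]; auto.
  { now rewrite d_refl. }
  { now rewrite s1. }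
  destruct (oO _ Oz) as [delta [Hd HD]].
  exists (Rmin delta r0). split; [now apply Rmin_pos|].
  intros w Hw. assert (H1 := Rmin_l delta r0). assert (H2 := Rmin_r delta r0).
  assert (H3 := lifted_lip z w).
  rewrite <- (sec_unique z w) by lra. apply HO; [lra|]. apply HD. lra.
Qed.

Lemma lifted_chain a b eps eta : eps > 0 -> eta > 0 ->
  exists l, chain e eps a b l /\ l < e a b + eta.
Proof.
  intros He Heta. destruct (proj2 (e_lifted a b) eta Heta) as [L [[g [[gC [g0 g1]] HL]] H]].
  destruct (chain_along_path M op e lifted_sym lifted_tri lifted_fine
    d rho g r0 L eps 1) as [l [Cl Hl]]; auto using lifted_local.
  { unfold unitI; lra. }
  exists l. rewrite g0, g1 in Cl. split; [assumption|lra].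
Qed.

Lemma base_chain x y eps eta : eps > 0 -> eta > 0 ->
  exists l, chain d eps x y l /\ l < d x y + eta.
Proof.
  intros He Heta. destruct (proj2 d_length x y (eta / 2)) as [g [[gC [g0 g1]] HL]]; [lra|].
  destruct (chain_along_path X (mopen d) d d_sym d_tri (fine_nbhds_mopen d d_refl d_tri)
    d (fun x => x) g 1 (d x y + eta / 2) eps 1) as [l [Cl Hl]]; auto; try lra.
  { intros z w _. lra. }
  { unfold unitI; lra. }
  exists l. rewrite g0, g1 in Cl. split; [assumption|lra].
Qed.

Lemma lifted_short_path z w eps : e z w < eps ->
  exists g, is_path op g z w /\ forall t, unitI t -> e z (g t) < eps.
Proof.
  intros H. destruct (proj2 (e_lifted z w) (eps - e z w)) as [L [[g [Hg HL]] HL']]; [lra|].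
  exists g. split; [assumption|]. intros t Ht. destruct Hg as [gC [g0 g1]].
  destruct (chain_along_path M op e lifted_sym lifted_tri lifted_fine
    d rho g r0 L 1 t) as [l [Cl Hl]]; auto using lifted_local; [lra|].
  apply (chain_dist M e lifted_refl lifted_tri) in Cl. rewrite g0 in Cl. lra.
Qed.

Lemma lifted_trivial_monodromy : simply_connected op -> trivial_monodromy e.
Proof.
  apply (simply_connected_trivial_monodromy M op e lifted_refl lifted_sym lifted_tri lifted_fine).
  - exact lifted_coarse.
  - exact lifted_short_path.
Qed.

(* Far from z the lift is an arbitrary preimage: [coherent] asks for [rho (lft z y) = y]
   everywhere. *)
Lemma total_lift_exists : exists lft : M -> X -> M,
  (forall z y, rho (lft z y) = y) /\
  (forall z y, d (rho z) y < r0 -> e z (lft z y) <= d (rho z) y) /\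
  (forall z w, e z w < r0 -> lft z (rho w) = w).
Proof.
  destruct rho_cover as [_ [Hsurj _]].
  set (pre := fun y => proj1_sig (constructive_indefinite_description _ (Hsurj y))).
  exists (fun z y => if Rlt_dec (d (rho z) y) r0 then sec z y else pre y).
  split; [|split].
  - intros z y. destruct Rlt_dec as [H|H].
    + now apply sec_local.
    + unfold pre. apply (proj2_sig (constructive_indefinite_description _ (Hsurj y))).
  - intros z y H. destruct Rlt_dec; [|contradiction]. now apply sec_near.
  - intros z w H. assert (H1 := lifted_lip z w).
    destruct Rlt_dec; [|lra]. now apply sec_unique.
Qed.

(** * Fibres and the fundamental group *)

Section Fibers.
Variable lft : M -> X -> M.
Hypothesis lft_rho : forall z y, rho (lft z y) = y.
Hypothesis lft_near : forall z y, d (rho z) y < r0 -> e z (lft z y) <= d (rho z) y.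
Hypothesis lft_unique : forall z w, e z w < r0 -> lft z (rho w) = w.

Let coh : coherent d rho lft (r0 / 2) :=
  coherent_lft M X e d rho lft r0 r0_pos lifted_refl lifted_tri lft_rho lft_near lft_unique.

Lemma loop_follow g w w' : is_path op g w w' -> exists N0, forall N, (N0 <= N)%nat ->
  follow X M lft (fun i => rho (g (grid N i))) w N = w'.
Proof.
  intros [gC [<- <-]].
  destruct (path_follow X d d_refl d_sym d_tri M rho lft (r0 / 2) ltac:(lra) coh g)
    as [N0 [_ H]].
  - intros t Ht W oW Wt. destruct (oW _ Wt) as [delta [Hd HD]].
    destruct (lifted_fine (g t) (Rmin delta r0)) as [V [oV [Vt HV]]]; [now apply Rmin_pos|].
    destruct (gC t Ht V oV Vt) as [delta' [Hd' H]].
    exists delta'. split; [assumption|]. intros s Hs Hst.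
    assert (H1 := HV _ (H s Hs Hst)).
    assert (H2 := Rmin_l delta r0). assert (H3 := Rmin_r delta r0).
    assert (H4 := lifted_lip (g t) (g s)).
    rewrite <- (lft_unique (g t) (g s)) by lra. apply HD. lra.
  - now exists N0.
Qed.

(** Send [w] to the class of the projection of a path from [w0] to [w]. This is injective, since
    homotopic loops transport [w0] to the same point. *)
Lemma pi1_fiber_bound x0 n : pi1_card (mopen d) x0 n ->
  (forall a b : M, exists g, is_path op g a b) ->
  forall l, NoDup l -> (forall w, In w l -> rho w = x0) -> (length l <= n)%nat.
Proof.
  intros [Lp [_ [_ HL]]] Hconn l Nl Hl.
  destruct l as [|w0 l']; [simpl; lia|]. remember (w0 :: l') as l eqn:El.
  assert (Hw0 : rho w0 = x0) by (apply Hl; subst; now left).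
  assert (Hi : forall w, exists i, In w l -> (i < n)%nat /\ exists g, is_path op g w0 w /\
    homotopic (mopen d) (fun t => rho (g t)) (Lp i)).
  { intros w. destruct (classic (In w l)) as [Iw|Iw]; [|exists 0%nat; tauto].
    destruct (Hconn w0 w) as [g Hg]. assert (Hg' := Hg). destruct Hg' as [gC [g0 g1]].
    destruct (HL (fun t => rho (g t))) as [i [Hi1 Hi2]].
    - split; [|split].
      + intros t Ht W oW Wt.
        apply (gC t Ht (fun z => W (rho z))); [|assumption]. now apply rho_cover.
      + now rewrite g0.
      + rewrite g1. auto.
    - exists i. intros _. split; [assumption|]. now exists g. }
  set (c := fun w => proj1_sig (constructive_indefinite_description _ (Hi w))).
  assert (Hc : forall w, In w l -> (c w < n)%nat /\ exists g, is_path op g w0 w /\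
    homotopic (mopen d) (fun t => rho (g t)) (Lp (c w))).
  { intros w. unfold c. apply (proj2_sig (constructive_indefinite_description _ (Hi w))). }
  assert (Nc : NoDup (map c l)).
  { apply NoDup_map_NoDup_ForallPairs; [|assumption].
    intros w w' Iw Iw' E.
    destruct (Hc w Iw) as [_ [g [Hg Hh]]]. destruct (Hc w' Iw') as [_ [g' [Hg' Hh']]].
    rewrite <- E in Hh'.
    destruct (loop_follow _ _ _ Hg) as [N1 H1]. destruct (loop_follow _ _ _ Hg') as [N2 H2].
    assert (HF := homotopic_follow X (mopen d) d d_sym d_tri
      (fine_nbhds_mopen d d_refl d_tri) M rho lft (r0 / 2) ltac:(lra) coh).
    destruct (HF _ _ Hh) as [N3 [_ H3]]. destruct (HF _ _ Hh') as [N4 [_ H4]].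
    set (N := (N1 + N2 + N3 + N4)%nat).
    rewrite <- (H1 N), <- (H2 N) by lia.
    rewrite (H3 N), (H4 N); [reflexivity|lia| |lia|].
    - destruct Hg' as [_ [-> _]]. reflexivity.
    - destruct Hg as [_ [-> _]]. reflexivity. }
  rewrite <- (length_map c l), <- (length_seq n 0).
  apply NoDup_incl_length; [assumption|].
  intros i Ii. apply in_map_iff in Ii. destruct Ii as [w [<- Iw]].
  apply in_seq. destruct (Hc w Iw). lia.
Qed.

(** Each step of a chain from [x0] to [rho z] injects the new fibre into the previous one; coherence
    makes the reverse transport a left inverse. *)
Lemma fiber_bound_transfer x0 n :
  (forall l, NoDup l -> (forall w, In w l -> rho w = x0) -> (length l <= n)%nat) ->
  forall z l, NoDup l -> (forall w, In w l -> rho w = rho z) -> (length l <= n)%nat.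
Proof.
  intros H0 z. destruct (base_chain x0 (rho z) (r0 / 2) 1) as [len [C _]]; [lra|lra|].
  induction C as [|b c len C IH Hbc]; [assumption|].
  intros l Nl Hl. rewrite <- (length_map (fun w => lft w b) l).
  destruct coh as [c1 [c2 c3]].
  apply IH.
  - apply (NoDup_map_inv (fun w => lft w c)). rewrite map_map.
    rewrite (map_ext_in _ (fun w => w)), map_id; [assumption|].
    intros w Iw. apply Hl in Iw. rewrite c3; rewrite ?Iw.
    + rewrite <- Iw. apply c2.
    + now rewrite d_sym.
    + assumption.
    + rewrite d_refl. lra.
  - intros w Iw. apply in_map_iff in Iw. destruct Iw as [u [<- _]]. apply lft_rho.
Qed.

End Fibers.

End LiftedMetric.

End Cover.

(** * The diameter as a supremum and the strict bound *)

Theorem theorem2 (X : Type) (d : X -> X -> R) (Xt : Type)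
  (opXt : (Xt -> Prop) -> Prop) (rho : Xt -> X) (n : nat) (x0 : X) (DX : R) :
  length_space d -> compact_metric d ->
  is_diam d DX -> DX > 0 ->
  universal_cover opXt (mopen d) rho ->
  pi1_card (mopen d) x0 n ->
  exists DXt, DXt < 4 * sqrt (INR n) * DX /\
    (forall a b : Xt, lifted_dist_le opXt d rho a b DXt) /\
    (forall e, e > 0 -> exists a b : Xt, ~ lifted_dist_le opXt d rho a b (DXt - e)).
Proof.
  intros Hlen Hcomp [Hdiam _] HD [Htop [Hcov Hsc]] Hpi.
  destruct (lifted_metric_exists X d Xt opXt rho Hlen Hcomp Htop Hcov (proj1 Hsc)) as [e He].
  destruct (local_section_exists X d Xt opXt rho Hlen Hcomp Htop Hcov) as [r0 [Hr Hsec]].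
  set (sec := fun z => proj1_sig (constructive_indefinite_description _ (Hsec z))).
  assert (Hsec' : forall z, local_section X d Xt opXt rho r0 z (sec z)).
  { intros z. apply (proj2_sig (constructive_indefinite_description _ (Hsec z))). }
  destruct (total_lift_exists X d Xt opXt rho Hlen Hcov e r0 sec He Hsec')
    as [lft [lft_rho [lft_near lft_unique]]].
  assert (e_refl := lifted_refl X d Xt opXt rho Hlen e He).
  assert (e_tri := lifted_tri X d Xt opXt rho Hlen e He).
  assert (Hle := lifted_dist_le_iff X d Xt opXt rho e He).
  assert (Hfib0 := pi1_fiber_bound X d Xt opXt rho Hlen Htop Hcov e r0 sec He Hr Hsec'
    lft lft_rho lft_near lft_unique x0 n Hpi (proj1 Hsc)).
  assert (Hfib := fiber_bound_transfer X d Xt opXt rho Hlen e r0 He Hr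
    lft lft_rho lft_near lft_unique x0 n Hfib0).
  assert (Hn : (1 <= n)%nat).
  { destruct Hpi as [Lp [_ [_ HL]]].
    destruct (HL _ (is_path_const _ x0)) as [i [Hi _]]. lia. }
  (* The right inequality contradicts [dist_fiber_bound] for distances above [2 * m * DX]; the left
     one makes the final bound strict. *)
  assert (Hm : exists m, (m * m < 4 * n <= S m * S m)%nat).
  { assert (K : forall k, (k * k < 4 * n)%nat \/ exists m, (m * m < 4 * n <= S m * S m)%nat).
    { induction k as [|k [IH|IH]]; [left; lia| |now right].
      destruct (Nat.lt_ge_cases (S k * S k) (4 * n)); [now left|].
      right. now exists k. }
    destruct (K (4 * n)%nat) as [H|H]; [nia|assumption]. }
  destruct Hm as [m [Hm1 Hm2]].
  assert (Hbound : forall p q, e p q <= 2 * INR m * DX).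
  { intros p q. apply Rnot_lt_le. intros Hlt.
    assert (H := dist_fiber_bound Xt X e d rho lft r0 DX n Hr HD
      (lifted_pos X d Xt opXt rho Hlen e He) e_refl
      (lifted_sym X d Xt opXt rho Hlen e He) e_tri
      (lifted_lip X d Xt opXt rho Hlen e He) lft_rho lft_near lft_unique
      (lifted_chain X d Xt opXt rho Hlen Htop Hcov e r0 sec He Hr Hsec')
      (base_chain X d Hlen) Hdiam
      (lifted_trivial_monodromy X d Xt opXt rho Hlen Htop Hcov e r0 sec He Hr Hsec' Hsc)
      Hfib p q m Hlt).
    lia. }
  assert (Hstrict : 2 * INR m * DX < 4 * sqrt (INR n) * DX).
  { apply Rmult_lt_compat_r; [assumption|].
    assert (H1 : INR m * INR m < 4 * INR n).
    { rewrite <- mult_INR. replace 4 with (INR 4) by (simpl; ring).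
      rewrite <- mult_INR. now apply lt_INR. }
    assert (H2 := pos_INR m). assert (H3 := pos_INR n).
    assert (H4 := sqrt_sqrt (INR n) H3). assert (H5 := sqrt_pos (INR n)). nra. }
  destruct (proj1 (proj2 Hcov) x0) as [z0 _].
  destruct (completeness (fun t => exists a b, t = e a b)) as [DXt [H1 H2]].
  { exists (2 * INR m * DX). intros t [a [b ->]]. apply Hbound. }
  { now exists (e z0 z0), z0, z0. }
  exists DXt. split; [|split].
  - apply Rle_lt_trans with (2 * INR m * DX); [|assumption].
    apply H2. intros t [a [b ->]]. apply Hbound.
  - intros a b. apply Hle, H1. now exists a, b.
  - intros eps Heps. apply NNPP. intros N.
    assert (H : DXt <= DXt - eps); [|lra].
    apply H2. intros t [a [b ->]]. apply Rnot_lt_le. intros L.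
    apply N. exists a, b. rewrite Hle. lra.
Qed.
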